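(* Let $Q_{16}=\langle X,Y \mid X^8=1,\ Y^2=X^4,\ XY=YX^{-1}\rangle$ be the dicyclic (generalized quaternion) group of order $16$, and let $$\mathcal{S}(Q_{16})=\left\{\det\left(a_{gh^{-1}}\right)_{g,h\in Q_{16}} \;:\; (a_g)_{g\in Q_{16}}\in\mathbb{Z}^{Q_{16}}\right\}\subseteq\mathbb{Z}$$ be the set of integer group determinants for $Q_{16}$. Then: (i) the even elements of $\mathcal{S}(Q_{16})$ are exactly the integer multiples of $2^{10}$; (ii) the odd elements of $\mathcal{S}(Q_{16})$ are exactly the integers $n$ with $n\equiv 1 \pmod 8$, together with those integers $n\equiv 5\pmod 8$ of the form $n=mp^2$ where $m$ is an integer with $m\equiv 5\pmod 8$ and $p$ is a prime with $p\equiv 7\pmod 8$.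
   Context: For a finite group $G$ and an element $\sum_{g\in G}a_g g$ of the group ring $\mathbb{Z}[G]$, the group determinant is $\mathcal{D}_G\left(\sum_{g\in G}a_g g\right)=\det\left(a_{gh^{-1}}\right)$, the determinant of the $|G|\times|G|$ matrix whose rows and columns are indexed by $g,h\in G$ (in the same order) and whose $(g,h)$ entry is $a_{gh^{-1}}$. The integer group determinants for $G$ are the values $\mathcal{D}_G$ takes on $\mathbb{Z}[G]$. Integers (in particular $n$, $m$ and multiples of $2^{10}$) may be positive, negative or, where the congruences allow it, zero; primes are positive. *)

(* Defs.v *)
From HB Require Import structures.
From mathcomp Require Import all_boot all_order all_algebra all_fingroup all_solvable.

Set Implicit Arguments.
Unset Strict Implicit.
Unset Printing Implicit Defensive.

Import GRing.Theory.
Local Open Scope ring_scope.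

(* An element of the group ring R[gT] is given by its coefficients
   a : {ffun gT -> R}.  Rows and columns are both indexed through the same
   enumeration enum_val of gT. *)
Definition group_mx (R : comNzRingType) (gT : finGroupType)
    (a : {ffun gT -> R}) : 'M[R]_#|gT| :=
  \matrix_(i, j) a (enum_val i * (enum_val j)^-1)%g.

Definition group_det (R : comNzRingType) (gT : finGroupType)
    (a : {ffun gT -> R}) : R := \det (group_mx a).

Definition int_group_det (gT : finGroupType) (n : int) : Prop :=
  exists a : {ffun gT -> int}, group_det a = n.

(* For finite groups, \isog Grp characterises the group up to isomorphism;
   Q16_presentationP below shows that such groups exist. *)
Definition Q16_presentation (gT : finGroupType) : Prop :=
  ([set: gT] \isog Grp (x : y : x ^+ 8 = 1, y ^+ 2 = x ^+ 4, x * y = y * x^-1))%g.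

Lemma Q16_presentationP : Q16_presentation 'Q_16.
Proof.
have isoQ := @Grp_quaternion 4 isT; move=> rT H; rewrite (isoQ rT H).
apply/existsP/existsP => -[[x y]] /=; rewrite !xpair_eqE.
  case/and4P=> defH x8 y2 xy; exists (x, y); rewrite /= !xpair_eqE.
  by rewrite defH x8 y2 /= conjgC (eqP xy).
case/and4P=> defH x8 y2 xy; exists (x, y); rewrite /= !xpair_eqE.
by rewrite defH x8 y2 /= conjgE (eqP xy) mulKg.
Qed.

(* Main.v *)
(* Write an element of Z[Q16] as f(X) + g(X) Y.  A Fourier transform over the
   8th roots of unity turns its determinant into A B C^2 N^2, where
   A = f(1)^2 - g(1)^2, B = f(-1)^2 - g(-1)^2, C = |f(i)|^2 - |g(i)|^2 and
   N = u^2 - 2 v^2 is the norm of u + v sqrt 2 = |f(w)|^2 + |g(w)|^2 >= 0.  The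
   residues of f and g mod x^4 - 1 (giving A, B, C) and mod x^4 + 1 (giving N)
   are tied only by congruence mod 2, and parities show that an even value is
   divisible by 2^10, and that an odd value is 1 mod 8, or is 5 mod 8 with
   N = 7 mod 8.  In the latter case N has a prime factor p = 7 mod 8, because 2
   is not a square modulo primes that are 3 or 5 mod 8.

   Conversely, small families give everything once each prime p = 7 mod 8 is a
   value of N with prescribed parities.  Write p = u^2 - 2 v^2 with u > 0, and
   p = e^2 + 2 (x^2 + y^2 + z^2) by Hermite reduction of a quaternary form of
   determinant 8.  The quaternion v + x i + y j + z k then has norm
   (u + e) (u - e) / 2, and the Euclidean algorithm writes it as S A^bar with
   |S|^2 = u + e and |A|^2 = (u - e) / 2; the coordinates of S and A give f(w)
   and g(w). *)

Require Import Defs.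
From HB Require Import structures.
From mathcomp Require Import all_boot all_order all_algebra all_fingroup all_solvable.
From mathcomp Require Import all_field.
From mathcomp Require Import zify ring.

Set Implicit Arguments.
Unset Strict Implicit.
Unset Printing Implicit Defensive.

Import Order.TTheory GRing.Theory Num.Theory.
Local Open Scope ring_scope.

(** * Parity and odd squares modulo 8 *)

Lemma int_parity (c : int) : (exists h, c = 2 * h) \/ (exists h, c = 2 * h + 1).
Proof.
have : (c %% 2)%Z = 0 \/ (c %% 2)%Z = 1 by clear; lia.
by have := divz_eq c 2 => cE [] c2; rewrite c2 in cE; [left | right];
  exists (c %/ 2)%Z; rewrite {1}cE; ring.
Qed.

Lemma odd_sqr8 (h : int) : exists w, (2 * h + 1) ^+ 2 = 8 * w + 1.
Proof.
have [[w ->]|[w ->]] := int_parity h; first by exists (w * (2 * w + 1)); ring.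
by exists ((2 * w + 1) * (w + 1)); ring.
Qed.

(** * Hermite reduction of quaternary forms *)

Lemma round_div (a n : int) : 0 < n -> exists q, - n < 2 * (a - q * n) <= n.
Proof.
move=> n0; exists ((2 * a + n - 1) %/ (2 * n))%Z.
have := divz_eq (2 * a + n - 1) (2 * n).
have : 0 <= ((2 * a + n - 1) %% (2 * n))%Z by apply: modz_ge0; lia.
have : ((2 * a + n - 1) %% (2 * n))%Z < 2 * n by apply: ltz_pmod; lia.
move: (_ %% _)%Z (_ %/ _)%Z => r q; lia.
Qed.

Record qform4 := QForm4 {
  g11 : int; g12 : int; g13 : int; g14 : int;
  g22 : int; g23 : int; g24 : int; g33 : int; g34 : int; g44 : int }.

Definition qeval (g : qform4) (t1 t2 t3 t4 : int) : int :=
  g11 g * t1 ^+ 2 + g22 g * t2 ^+ 2 + g33 g * t3 ^+ 2 + g44 g * t4 ^+ 2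
  + 2 * (g12 g * t1 * t2 + g13 g * t1 * t3 + g14 g * t1 * t4
         + g23 g * t2 * t3 + g24 g * t2 * t4 + g34 g * t3 * t4).

Definition represents (g : qform4) (n : int) : Prop :=
  exists t1 t2 t3 t4, qeval g t1 t2 t3 t4 = n.

Definition det3 (a b c d e f : int) : int :=
  a * d * f + 2 * b * c * e - a * e ^+ 2 - d * c ^+ 2 - f * b ^+ 2.

Definition minor2 (g : qform4) : int := g11 g * g22 g - g12 g ^+ 2.
Definition minor3 (g : qform4) : int :=
  det3 (g11 g) (g12 g) (g13 g) (g22 g) (g23 g) (g33 g).
Definition disc4 (g : qform4) : int :=
  g44 g * minor3 g
  - g14 g ^+ 2 * (g22 g * g33 g - g23 g ^+ 2)
  - g24 g ^+ 2 * (g11 g * g33 g - g13 g ^+ 2)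
  - g34 g ^+ 2 * minor2 g
  - 2 * g14 g * g24 g * (g13 g * g23 g - g12 g * g33 g)
  - 2 * g14 g * g34 g * (g12 g * g23 g - g13 g * g22 g)
  - 2 * g24 g * g34 g * (g12 g * g13 g - g11 g * g23 g).

(* The form in the basis (b2 - t b1, b1, b3, b4). *)
Definition step12 (t : int) (g : qform4) : qform4 :=
  QForm4 (g22 g - 2 * t * g12 g + t ^+ 2 * g11 g) (g12 g - t * g11 g)
    (g23 g - t * g13 g) (g24 g - t * g14 g)
    (g11 g) (g13 g) (g14 g) (g33 g) (g34 g) (g44 g).

(* The form in the basis (b1, b3 - t b2, b2, b4). *)
Definition step23 (t : int) (g : qform4) : qform4 :=
  QForm4 (g11 g) (g13 g - t * g12 g) (g12 g) (g14 g)
    (g33 g - 2 * t * g23 g + t ^+ 2 * g22 g) (g23 g - t * g22 g)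
    (g34 g - t * g24 g) (g22 g) (g24 g) (g44 g).

(* The form in the basis (b1, b2, b4 - t b3, b3). *)
Definition step34 (t : int) (g : qform4) : qform4 :=
  QForm4 (g11 g) (g12 g) (g14 g - t * g13 g) (g13 g)
    (g22 g) (g24 g - t * g23 g) (g23 g)
    (g44 g - 2 * t * g34 g + t ^+ 2 * g33 g) (g34 g - t * g33 g) (g33 g).

Lemma represents_step12 t g n : represents (step12 t g) n -> represents g n.
Proof.
case=> t1 [t2 [t3 [t4 <-]]]; exists (t2 - t * t1), t1, t3, t4.
by rewrite /qeval /=; ring.
Qed.

Lemma represents_step23 t g n : represents (step23 t g) n -> represents g n.
Proof.
case=> t1 [t2 [t3 [t4 <-]]]; exists t1, (t3 - t * t2), t2, t4.
by rewrite /qeval /=; ring.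
Qed.

Lemma represents_step34 t g n : represents (step34 t g) n -> represents g n.
Proof.
case=> t1 [t2 [t3 [t4 <-]]]; exists t1, t2, (t4 - t * t3), t3.
by rewrite /qeval /=; ring.
Qed.

(* In a basis exchange, a, d, b are consecutive leading minors, l is the
   size-reduced off-diagonal minor and d' replaces d. *)
Lemma exchange_lt (a b d d' l : int) : 0 < a -> 0 < b -> 0 < d ->
  4 * (a * b) < 3 * d ^+ 2 -> - d < 2 * l <= d -> d * d' = a * b + l ^+ 2 ->
  0 < d' < d.
Proof.
move=> a0 b0 d0 ab hl e.
have l2 : 4 * l ^+ 2 <= d ^+ 2 by nia.
have ab0 : 0 < a * b by rewrite mulr_gt0.
by apply/andP; split; nia.
Qed.

(** These are the Hermite conditions between consecutive leading minors, the fourth being 8.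
    Squaring the second and multiplying the other two eliminates [d1] and [d3]:
    [81 * d2 ^+ 2 <= 2048], whereas [d1 >= 3] would force [4 * d2 >= 27]. *)
Lemma hermite_bound (d1 d2 d3 : int) : 0 < d1 -> 0 < d2 -> 0 < d3 ->
  3 * d1 ^+ 2 <= 4 * d2 -> 3 * d2 ^+ 2 <= 4 * (d1 * d3) ->
  3 * d3 ^+ 2 <= 4 * (d2 * 8) -> d1 <= 2.
Proof.
move=> h1 h2 h3 e1 e2 e3; rewrite leNgt; apply/negP => d13.
have h27 : 27 <= 4 * d2 by nia.
have e22 : 9 * (d2 ^+ 2 * d2 ^+ 2) <= 16 * (d1 ^+ 2 * d3 ^+ 2).
  have : (3 * d2 ^+ 2) ^+ 2 <= (4 * (d1 * d3)) ^+ 2.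
    by rewrite lerXn2r ?nnegrE //; nia.
  by congr (_ <= _); ring.
have e123 : 9 * (d1 ^+ 2 * d3 ^+ 2) <= 128 * d2 ^+ 2.
  have : (3 * d1 ^+ 2) * (3 * d3 ^+ 2) <= (4 * d2) * (4 * (d2 * 8)).
    by rewrite ler_pM //; nia.
  by congr (_ <= _); ring.
have : 81 * (d2 ^+ 2 * d2 ^+ 2) <= 2048 * d2 ^+ 2 by lia.
by rewrite mulrA ler_pM2r ?exprn_gt0 //; nia.
Qed.

(* Each exchange decreases the sum of the first three leading minors and
   preserves the discriminant. *)
Lemma hermite4 (g : qform4) :
  0 < g11 g -> 0 < minor2 g -> 0 < minor3 g -> disc4 g = 8 ->
  exists n, represents g n /\ 0 < n <= 2.
Proof.
have [k] := ubnP (absz (g11 g + minor2 g + minor3 g)).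
elim: k g => // k IH g hk d1 d2 d3 d4.
have [e1|e1] := ltP (4 * (1 * minor2 g)) (3 * g11 g ^+ 2).
  have [t ht] := round_div (g12 g) d1.
  have := exchange_lt ltr01 d2 d1 e1 ht (d' := g11 (step12 t g)).
  case/(_ _)/andP=> [|p1 lt1]; first by rewrite /minor2 /=; ring.
  have E2 : minor2 (step12 t g) = minor2 g by rewrite /minor2 /=; ring.
  have E3 : minor3 (step12 t g) = minor3 g by rewrite /minor3 /det3 /=; ring.
  have E4 : disc4 (step12 t g) = disc4 g.
    by rewrite /disc4 /minor3 /det3 /minor2 /=; ring.
  have [|||||n [rn hn]] := IH (step12 t g); rewrite ?E2 ?E3 ?E4 //;
    first by lia.
  by exists n; split=> //; apply: represents_step12 rn.
have [e2|e2] := ltP (4 * (g11 g * minor3 g)) (3 * minor2 g ^+ 2).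
  have [t ht] := round_div (g11 g * g23 g - g12 g * g13 g) d2.
  have := exchange_lt d1 d3 d2 e2 ht (d' := minor2 (step23 t g)).
  case/(_ _)/andP=> [|p2 lt2]; first by rewrite /minor3 /det3 /minor2 /=; ring.
  have E3 : minor3 (step23 t g) = minor3 g by rewrite /minor3 /det3 /=; ring.
  have E4 : disc4 (step23 t g) = disc4 g.
    by rewrite /disc4 /minor3 /det3 /minor2 /=; ring.
  have [|||||n [rn hn]] := IH (step23 t g); rewrite ?E3 ?E4 //.
    by rewrite /= in hk *; lia.
  by exists n; split=> //; apply: represents_step23 rn.
have [e3|e3] := ltP (4 * (minor2 g * disc4 g)) (3 * minor3 g ^+ 2).
  (* The minor on rows 1, 2, 3 and columns 1, 2, 4; divided by [minor3 g] it is the Gram-Schmidt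
     coefficient of the fourth basis vector along the third. *)
  have [t ht] := round_div
    (g34 g * minor2 g - g14 g * (g13 g * g22 g - g12 g * g23 g)
     - g24 g * (g11 g * g23 g - g12 g * g13 g)) d3.
  have d4' : 0 < disc4 g by rewrite d4.
  have := exchange_lt d2 d4' d3 e3 ht (d' := minor3 (step34 t g)).
  case/(_ _)/andP=> [|p3 lt3].
    by rewrite /disc4 /minor3 /det3 /minor2 /=; ring.
  have E4 : disc4 (step34 t g) = disc4 g.
    by rewrite /disc4 /minor3 /det3 /minor2 /=; ring.
  have [|||||n [rn hn]] := IH (step34 t g); rewrite ?E4 //.
    by rewrite /minor2 /= -/(minor2 g) in hk *; lia.
  by exists n; split=> //; apply: represents_step34 rn.
exists (g11 g); split; first by exists 1, 0, 0, 0; rewrite /qeval; ring.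
rewrite d1 /=; apply: (hermite_bound d1 d2 d3) => //; last by rewrite -d4.
by rewrite mul1r in e1.
Qed.

(** * Integral quaternions *)

Definition int4 := (int * int * int * int)%type.

Definition sqn (a : int4) : int :=
  let: (a0, a1, a2, a3) := a in a0 ^+ 2 + a1 ^+ 2 + a2 ^+ 2 + a3 ^+ 2.

Definition add4 (a b : int4) : int4 :=
  let: (a0, a1, a2, a3) := a in let: (b0, b1, b2, b3) := b in
  (a0 + b0, a1 + b1, a2 + b2, a3 + b3).

Definition scale4 (k : int) (a : int4) : int4 :=
  let: (a0, a1, a2, a3) := a in (k * a0, k * a1, k * a2, k * a3).

Definition qconj (a : int4) : int4 :=
  let: (a0, a1, a2, a3) := a in (a0, - a1, - a2, - a3).

Definition qmul (a b : int4) : int4 :=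
  let: (a0, a1, a2, a3) := a in let: (b0, b1, b2, b3) := b in
  (a0 * b0 - a1 * b1 - a2 * b2 - a3 * b3,
   a0 * b1 + a1 * b0 + a2 * b3 - a3 * b2,
   a0 * b2 - a1 * b3 + a2 * b0 + a3 * b1,
   a0 * b3 + a1 * b2 - a2 * b1 + a3 * b0).

Definition dvd4 (d : int) (a : int4) : bool :=
  let: (a0, a1, a2, a3) := a in
  [&& (d %| a0)%Z, (d %| a1)%Z, (d %| a2)%Z & (d %| a3)%Z].

Definition dot4 (a b : int4) : int :=
  let: (a0, a1, a2, a3) := a in let: (b0, b1, b2, b3) := b in
  a0 * b0 + a1 * b1 + a2 * b2 + a3 * b3.

Lemma sqn_ge0 a : 0 <= sqn a.
Proof. by case: a => [[[a0 a1] a2] a3] /=; rewrite !addr_ge0 ?sqr_ge0. Qed.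

Lemma sqn_qconj a : sqn (qconj a) = sqn a.
Proof. by case: a => [[[a0 a1] a2] a3] /=; ring. Qed.

Lemma sqn_qmul a b : sqn (qmul a b) = sqn a * sqn b.
Proof.
by case: a b => [[[a0 a1] a2] a3] [[[b0 b1] b2] b3] /=; ring.
Qed.

Lemma sqn_addZ a b k :
  sqn (add4 a (scale4 k b)) = sqn a + 2 * k * dot4 a b + k ^+ 2 * sqn b.
Proof.
by case: a b => [[[a0 a1] a2] a3] [[[b0 b1] b2] b3] /=; ring.
Qed.

Lemma qconjK a : qconj (qconj a) = a.
Proof. by case: a => [[[a0 a1] a2] a3] /=; rewrite !opprK. Qed.

Lemma qconj_mul a b : qconj (qmul a b) = qmul (qconj b) (qconj a).
Proof.
case: a b => [[[a0 a1] a2] a3] [[[b0 b1] b2] b3] /=.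
by congr (_, _, _, _); ring.
Qed.

Lemma qmul_addl a b c : qmul (add4 a b) c = add4 (qmul a c) (qmul b c).
Proof.
case: a b c => [[[a0 a1] a2] a3] [[[b0 b1] b2] b3] [[[c0 c1] c2] c3] /=.
by congr (_, _, _, _); ring.
Qed.

Lemma qmul_mulKc q a : qmul (qmul q a) (qconj a) = scale4 (sqn a) q.
Proof.
case: q a => [[[a0 a1] a2] a3] [[[b0 b1] b2] b3] /=.
by congr (_, _, _, _); ring.
Qed.

Lemma dvd4_qconj d a : dvd4 d (qconj a) = dvd4 d a.
Proof. by case: a => [[[a0 a1] a2] a3] /=; rewrite !rpredN. Qed.

Lemma dvd4_addZ d a b k : (d %| k)%Z -> dvd4 d a ->
  dvd4 d (add4 a (scale4 k b)).
Proof.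
case: a b => [[[a0 a1] a2] a3] [[[b0 b1] b2] b3] /= dk /and4P[*].
by apply/and4P; split; rewrite rpredD // dvdz_mulr.
Qed.

Lemma dvdz_dot4 d a b : dvd4 d a -> (d %| dot4 a b)%Z.
Proof.
case: a b => [[[a0 a1] a2] a3] [[[b0 b1] b2] b3] /= /and4P[*].
by rewrite !rpredD // dvdz_mulr.
Qed.

Lemma sqn_eq0 a : sqn a = 0 -> a = (0, 0, 0, 0).
Proof.
by case: a => [[[a0 a1] a2] a3] /= h; congr (_, _, _, _); nia.
Qed.

(** Rounding each coordinate leaves at most [n / 2], so the norm of the remainder reaches [n ^+ 2]
    only if all four coordinates equal [n / 2]. This is the one failure of Euclidean division for
    quaternions with integer coordinates. *)
Lemma round_div4 (p : int4) (n : int) : 0 < n ->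
  exists q r, p = add4 r (scale4 n q) /\
    (sqn r < n ^+ 2 \/ exists k, n = 2 * k /\ r = (k, k, k, k)).
Proof.
case: p => [[[p0 p1] p2] p3] n0.
have [q0 h0] := round_div p0 n0; have [q1 h1] := round_div p1 n0.
have [q2 h2] := round_div p2 n0; have [q3 h3] := round_div p3 n0.
exists (q0, q1, q2, q3),
  (p0 - q0 * n, p1 - q1 * n, p2 - q2 * n, p3 - q3 * n); split.
  by congr (_, _, _, _); ring.
move: (p0 - _) (p1 - _) (p2 - _) (p3 - _) h0 h1 h2 h3 => r0 r1 r2 r3 h0 h1 h2
  h3.
have sq (r : int) : - n < 2 * r <= n -> 4 * r ^+ 2 <= n ^+ 2 by move=> ?; nia.
have sqlt (r : int) : - n < 2 * r <= n -> 2 * r != n -> 4 * r ^+ 2 < n ^+ 2.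
  by move=> h /eqP ne; have lt : 2 * r < n; [lia | nia].
have [e0|ne0] := eqVneq (2 * r0) n; last first.
  by left; rewrite /=; move: (sqlt _ h0 ne0) (sq _ h1) (sq _ h2) (sq _ h3); lia.
have [e1|ne1] := eqVneq (2 * r1) n; last first.
  by left; rewrite /=; move: (sq _ h0) (sqlt _ h1 ne1) (sq _ h2) (sq _ h3); lia.
have [e2|ne2] := eqVneq (2 * r2) n; last first.
  by left; rewrite /=; move: (sq _ h0) (sq _ h1) (sqlt _ h2 ne2) (sq _ h3); lia.
have [e3|ne3] := eqVneq (2 * r3) n; last first.
  by left; rewrite /=; move: (sq _ h0) (sq _ h1) (sq _ h2) (sqlt _ h3 ne3); lia.
by right; exists r0; split; [rewrite e0 | congr (_, _, _, _); lia].
Qed.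

(* Euclidean algorithm on the degenerate Hermitian matrix (m, p; p^bar, n):
   subtracting q times the second row from the first replaces p by p - n q. *)
Lemma quat_factor (m n : int) (p : int4) : 0 <= m -> 0 <= n ->
  sqn p = m * n ->
  (forall d, (d %| m)%Z -> (d %| n)%Z -> dvd4 d p -> absz d = 1) ->
  exists s a, [/\ sqn s = m, sqn a = n & qmul s (qconj a) = p].
Proof.
have [k] := ubnP (absz n).
elim: k m n p => // k IH m n p hk m0; rewrite le_eqVlt => /predU1P[<-|n0] np
  gcd1.
  move: np; rewrite mulr0 => /sqn_eq0 pE.
  have m1 : m = 1.
    by have := gcd1 m; rewrite pE /= dvdzz !dvdz0 => /(_ isT isT isT); lia.
  by exists (1, 0, 0, 0), (0, 0, 0, 0); rewrite m1 pE.
have [q [r [pE hr]]] := round_div4 p n0.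
(* The upper left entry once the column operation matching the row operation is done; the new matrix
   is again degenerate. *)
pose m' := m - 2 * dot4 r q - n * sqn q.
have rE : sqn r = m' * n.
  by move: np; rewrite pE sqn_addZ /m'; lia.
have lift s a : sqn a = n -> qmul s (qconj a) = r ->
    exists s a, [/\ sqn s = m, sqn a = n & qmul s (qconj a) = p].
  move=> an sa; exists (add4 s (qmul q a)), a.
  have saE : qmul (add4 s (qmul q a)) (qconj a) = p.
    by rewrite qmul_addl sa qmul_mulKc an -pE.
  split=> //; have := sqn_qmul (add4 s (qmul q a)) (qconj a).
  rewrite saE sqn_qconj an np => e.
  by apply: (mulIf (x := n)); rewrite ?gt_eqF.
have dvdm d : (d %| m')%Z -> (d %| n)%Z -> dvd4 d r -> absz d = 1.
  move=> dm dn dr; apply: gcd1 => //; last by rewrite pE dvd4_addZ.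
  have -> : m = m' + 2 * dot4 r q + n * sqn q by rewrite /m'; ring.
  clearbody m'.
  by rewrite !rpredD //; [exact: dvdz_mull _ (dvdz_dot4 _ dr) | exact:
    dvdz_mulr].
case: hr => [ltr|[h [nE rh]]].
  have m'0 : 0 <= m' by have := sqn_ge0 r; rewrite rE pmulr_lge0.
  have m'n : m' < n by move: ltr; rewrite rE expr2 ltr_pM2r.
  have [|||||s [a [sn am sa]]] := IH n m' (qconj r).
  - by lia.
  - by lia.
  - by [].
  - by rewrite sqn_qconj rE mulrC.
  - by move=> d dn dm; rewrite dvd4_qconj; apply: dvdm.
  by apply: (lift a s) => //; rewrite -[a]qconjK -qconj_mul sa qconjK.
(* In the exceptional case [m'], [n] and [r] are all divisible by [h], hence [h = 1], and
   [1 + i + j + k = (i + j) (1 - i)] is the factorization. *)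
have h1 : absz h = 1.
  apply: dvdm; first 1 last.
  - by rewrite nE dvdz_mull.
  - by rewrite rh /= !dvdzz.
  have -> : m' = 2 * h.
    by move: rE; rewrite rh nE /= => e; have : h != 0; nia.
  by rewrite dvdz_mull.
have {}h1 : h = 1 by lia.
by apply: (lift (0, 1, 1, 0) (1, 1, 0, 0)); rewrite ?nE ?rh h1.
Qed.

(** * Quadratic residues and forms modulo 8 *)

(** Applied to subgroups [S] of the units mod 8: if every prime factor had its residue in [S], so
    would [n]. *)
Lemma prime_divisor_mod8 (S : pred nat) (n : nat) : S 1%N ->
  (forall a b, S (a %% 8)%N -> S (b %% 8)%N -> S ((a * b) %% 8)%N) ->
  (0 < n)%N -> ~~ S (n %% 8)%N ->
  exists q, [/\ prime q, (q %| n)%N & ~~ S (q %% 8)%N].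
Proof.
move=> S1 SM; have [k] := ubnP n; elim: k n => // k IH n hk n0 Sn.
have n1 : (1 < n)%N by case: n n0 Sn {hk} => [|[|n]] //; rewrite modn_small ?S1.
have [Sp|] := boolP (S (pdiv n %% 8)%N); last first.
  by exists (pdiv n); rewrite pdiv_prime // pdiv_dvd.
have /dvdnP[c nE] := pdiv_dvd n.
have p1 : (1 < pdiv n)%N by rewrite prime_gt1 ?pdiv_prime.
have Sc : ~~ S (c %% 8)%N by apply: contra Sn => Sc; rewrite nE SM.
have [c0 ck] : (0 < c)%N /\ (c < k)%N.
  by clear -nE p1 hk n0; move: (pdiv n) nE p1 => d nE p1; split; nia.
have [q [q1 qc Sq]] := IH c ck c0 Sc.
by exists q; split; rewrite // nE dvdn_mulr.
Qed.

(** If [r] is the least nonnegative root, [p - r] is a root of the other parity. An odd root has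
    square 1 mod 8, which controls the residue of the cofactor in the descent. *)
Lemma odd_root_reduction (p : nat) (t : int) (c : int) : odd p ->
  ~~ (p %| c)%Z -> (p %| t ^+ 2 - c)%Z ->
  exists s : nat, [/\ odd s, (s < p)%N & (p %| s%:Z ^+ 2 - c)%Z].
Proof.
move=> podd pc ptc.
have p0 : (0 < p)%N by case: p podd {pc ptc}.
have r0 : 0 <= (t %% p)%Z by apply: modz_ge0; lia.
have rp : (t %% p)%Z < p by apply: ltz_pmod; lia.
have tE := divz_eq t p.
move: (t %% p)%Z (t %/ p)%Z r0 rp tE => r k r0 rp tE.
have rdvd : (p %| r ^+ 2 - c)%Z.
  have -> : r ^+ 2 - c = (t ^+ 2 - c) - p%:Z * (k * (2 * t - k * p)).
    by rewrite tE; ring.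
  by rewrite rpredB // dvdz_mulr.
have [rodd|reven] := boolP (odd (absz r)).
  by exists (absz r); split=> //; [lia | rewrite gez0_abs].
have rn0 : r != 0.
  by apply: contraNneq pc => r00; rewrite r00 expr0n sub0r rpredN in rdvd.
exists (absz (p%:Z - r)); split; [lia | lia | rewrite gez0_abs; last lia].
have -> : (p%:Z - r) ^+ 2 - c = r ^+ 2 - c + p%:Z * (p%:Z - 2 * r) by ring.
by rewrite rpredD // dvdz_mulr.
Qed.

(* Descent on p: if s < p is an odd root then s^2 - c = p q with q < p, and q
   has a prime factor whose residue is again outside S. *)
Lemma sqrt_mod_descent (c : int) (S : pred nat) (p : nat) (t : int) :
  (absz c = 2)%N -> S 1%N ->
  (forall a b, S (a %% 8)%N -> S (b %% 8)%N -> S ((a * b) %% 8)%N) ->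
  (forall (a b : nat) (w : int), odd a -> S (a %% 8)%N ->
    a%:Z * b%:Z = 8 * w + 1 - c -> S (b %% 8)%N) ->
  prime p -> odd p -> (p %| t ^+ 2 - c)%Z -> S (p %% 8)%N.
Proof.
move=> c2 S1 SM Sdiv; have [k] := ubnP p; elim: k p t => // k IH.
move=> p t hk pp podd pt.
have p1 := prime_gt1 pp.
have pc : ~~ (p %| c)%Z.
  by rewrite dvdzE c2 dvdn_prime2 //; apply/eqP; lia.
have [s [sodd sp /dvdzP[q sE]]] := odd_root_reduction podd pc pt.
have [h sh] : exists h : nat, s = (2 * h + 1)%N by exists s./2; lia.
have [w wE] : exists w : nat, (h * (h + 1) = 2 * w)%N.
  have : ~~ odd (h * (h + 1)) by rewrite oddM oddD; case: (odd h).
  by exists (h * (h + 1))./2; lia.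
have s8 : s%:Z ^+ 2 = 8 * w%:Z + 1.
  by rewrite sh; move: wE => /(congr1 Posz); rewrite !PoszM !PoszD; lia.
have p3 : 3 <= p%:Z by lia.
have q0 : 0 < q.
  rewrite ltNge; apply/negP => q0.
  have [q00|qN] : q = 0 \/ q <= -1 by lia.
    by move: sE; rewrite q00 mul0r s8; lia.
  have : q * p%:Z <= -1 * p%:Z by rewrite ler_wpM2r //; lia.
  by rewrite -sE s8; lia.
(* Both [s] and [p] are odd, so [s <= p - 2] and [s^2 - c <= (p - 2)^2 + 2 < p^2]. *)
have qp : q < p.
  rewrite -(ltr_pM2r (x := p%:Z)); last lia.
  have s2 : s%:Z <= p%:Z - 2 by lia.
  have : s%:Z ^+ 2 <= (p%:Z - 2) ^+ 2 by rewrite lerXn2r ?nnegrE; lia.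
  by rewrite -sE; lia.
have qodd : odd (absz q).
  have : odd (absz (q * p%:Z)) by rewrite -sE s8; lia.
  by rewrite abszM oddM => /andP[].
apply/negPn/negP => Sp.
have Sq : ~~ S (absz q %% 8)%N.
  apply: contra Sp => Sq; apply: (Sdiv _ _ w%:Z qodd Sq).
  by rewrite gez0_abs -?sE ?s8 //; lia.
have [|r [pr rq /negP]] := prime_divisor_mod8 S1 SM _ Sq; first by lia.
have rodd : odd r by case/dvdnP: rq qodd => ? ->; rewrite oddM => /andP[].
apply; apply: (IH r s%:Z) => //.
  by have := dvdn_leq _ rq; lia.
by rewrite sE dvdz_mulr // dvdzE.
Qed.

(** For odd [s] the number [s^2 - 2] is 7 mod 8, so if one of two cofactors lies in the subgroup 1,
    7 of the units, so does the other. For -2 the number is 3 mod 8 and the subgroup is 1, 3. *)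
Lemma sqrt2_mod (p : nat) (t : int) : prime p -> odd p ->
  (p %| t ^+ 2 - 2)%Z -> (p %% 8 = 1 \/ p %% 8 = 7)%N.
Proof.
move=> pp podd pt.
suff : (p %% 8 \in [:: 1; 7])%N by rewrite !inE => /orP[] /eqP; [left | right].
apply: (@sqrt_mod_descent 2 (mem [:: 1; 7]%N) p t) => // [a b|a b w aodd].
  by rewrite -modnMm /= !inE => /orP[] /eqP-> /orP[] /eqP->.
rewrite /= !inE => /orP[] /eqP a8 ab.
  have aE : a%:Z = 8 * (a %/ 8)%N%:Z + 1 by lia.
  rewrite aE in ab; move: (_ %/ _)%N ab => a' ab; lia.
have aE : a%:Z = 8 * (a %/ 8)%N%:Z + 7 by lia.
rewrite aE in ab; move: (_ %/ _)%N ab => a' ab; lia.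
Qed.

Lemma sqrtN2_mod (p : nat) (t : int) : prime p -> odd p ->
  (p %| t ^+ 2 + 2)%Z -> (p %% 8 = 1 \/ p %% 8 = 3)%N.
Proof.
move=> pp podd pt.
suff : (p %% 8 \in [:: 1; 3])%N by rewrite !inE => /orP[] /eqP; [left | right].
apply: (@sqrt_mod_descent (- 2) (mem [:: 1; 3]%N) p t) => // [a b|a b w aodd].
  by rewrite -modnMm /= !inE => /orP[] /eqP-> /orP[] /eqP->.
rewrite /= !inE => /orP[] /eqP a8 ab.
  have aE : a%:Z = 8 * (a %/ 8)%N%:Z + 1 by lia.
  rewrite aE in ab; move: (_ %/ _)%N ab => a' ab; lia.
have aE : a%:Z = 8 * (a %/ 8)%N%:Z + 3 by lia.
rewrite aE in ab; move: (_ %/ _)%N ab => a' ab; lia.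
Qed.

(** Such a [q] is inert in Z[sqrt 2]: were [v] invertible mod [q], the quotient [u / v] would be a
    square root of 2. *)
Lemma dvdz_norm2 (q : nat) (u v : int) : prime q -> odd q ->
  (q %% 8 = 3 \/ q %% 8 = 5)%N -> (q %| u ^+ 2 - 2 * v ^+ 2)%Z ->
  (q %| u)%Z && (q %| v)%Z.
Proof.
move=> pq qodd q8 quv.
have qv : (q %| v)%Z.
  apply/negPn/negP => qv.
  have [w [z wz]] := Bezoutz v q.
  have vq1 : gcdz v q = 1.
    by apply/eqP; rewrite -[_ == 1]/(coprimez v q) coprimezE coprime_sym
      prime_coprime.
  rewrite vq1 in wz.
  have [] := sqrt2_mod (t := u * w) pq qodd; last by lia.
    have -> : (u * w) ^+ 2 - 2 =
        (u ^+ 2 - 2 * v ^+ 2) * w ^+ 2 - q%:Z * (2 * z * (1 + w * v)).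
      have -> : q%:Z * (2 * z * (1 + w * v)) = z * q%:Z * (2 * (1 + w * v))
        by ring.
      have -> : z * q%:Z = 1 - w * v by rewrite -wz; ring.
      ring.
    by rewrite rpredB // dvdz_mulr.
  lia.
rewrite qv andbT; have : (q %| u ^+ 2)%Z.
  have -> : u ^+ 2 = (u ^+ 2 - 2 * v ^+ 2) + v * (2 * v) by ring.
  by rewrite rpredD // dvdz_mulr.
by rewrite !dvdzE abszX Euclid_dvdX // andbT.
Qed.

(** Some prime factor is not 1 mod 8. If it is 3 or 5 it divides both [u] and [v], and removing its
    square, which is 1 mod 8, preserves the residue 7 and decreases the norm. *)
Lemma norm2_prime7 (u v : int) : 0 < u ^+ 2 - 2 * v ^+ 2 ->
  (exists k, u ^+ 2 - 2 * v ^+ 2 = 8 * k + 7) ->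
  exists p : nat, [/\ prime p, (p %% 8 = 7)%N & (p %| u ^+ 2 - 2 * v ^+ 2)%Z].
Proof.
have [k] := ubnP (absz (u ^+ 2 - 2 * v ^+ 2)%R).
elim: k u v => // k IH u v hk E0 [e7 E7].
set E := u ^+ 2 - 2 * v ^+ 2 in hk E0 E7 *.
have En : E = (absz E)%:Z by lia.
have Eodd : odd (absz E) by lia.
have [|||q [pq qE q1]] := @prime_divisor_mod8 (pred1 1%N) (absz E) isT.
- by move=> a b /= /eqP a1 /eqP b1; rewrite -modnMm a1 b1.
- by lia.
- by rewrite /=; lia.
have qodd : odd q by case/dvdnP: qE Eodd => ? ->; rewrite oddM => /andP[].
have [q7|q7] := eqVneq (q %% 8)%N 7%N; first by exists q; rewrite dvdzE.
have q35 : (q %% 8 = 3 \/ q %% 8 = 5)%N by move: q1 => /= /eqP q1; lia.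
have /andP[/dvdzP[u' uE] /dvdzP[v' vE]] : (q %| u)%Z && (q %| v)%Z.
  by apply: dvdz_norm2 => //; rewrite dvdzE.
pose E' := u' ^+ 2 - 2 * v' ^+ 2.
have EE : E = q%:Z ^+ 2 * E' by rewrite /E uE vE /E'; ring.
have q3 : 3 <= q%:Z by have := prime_gt1 pq; clear -qodd; lia.
have E'0 : 0 < E' by move: E0; rewrite EE pmulr_rgt0 // exprn_gt0; lia.
have E'7 : exists k, E' = 8 * k + 7.
  have [w wE] : exists w, q%:Z ^+ 2 = 8 * w + 1.
    have [h qh] : exists h : nat, q%:Z = 8 * h%:Z + 3 \/ q%:Z = 8 * h%:Z + 5.
      by exists (q %/ 8)%N; clear -q35; lia.
    by case: qh => ->; [exists (8 * h%:Z ^+ 2 + 6 * h%:Z + 1) |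
       exists (8 * h%:Z ^+ 2 + 10 * h%:Z + 3)]; ring.
  by exists (e7 - w * E'); move: E7; rewrite EE wE; clear; lia.
have [|p [pp p7 pE]] := IH u' v' _ E'0 E'7.
  have : 1 * E' < q%:Z ^+ 2 * E' by rewrite ltr_pM2r //; clear -q3; nia.
  by rewrite -EE -/E'; clear -hk E0 E'0; lia.
by exists p; split; rewrite // EE dvdz_mull.
Qed.

(** * Representing primes congruent to 7 modulo 8 by quadratic forms *)

Lemma sqrt_or_sqrtN (p : nat) (a : int) : prime p -> (p %% 4 = 3)%N ->
  exists r : int, (p %| r ^+ 2 - a)%Z \/ (p %| r ^+ 2 + a)%Z.
Proof.
move=> pp p4; have cF := pchar_Fp pp.
(* The exponent is [(p + 1) / 4], so [y^4 = x^(p + 1) = x^2] by Fermat, and [y^2] is [x] or [-x]. *)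
pose x : 'F_p := a%:~R; pose y := x ^+ (p %/ 4).+1.
have y4 : (y ^+ 2 - x) * (y ^+ 2 + x) = 0.
  rewrite -subr_sqr -exprM -exprM.
  have -> : ((p %/ 4).+1 * (2 * 2) = p.+1)%N by lia.
  have := expf_card x; rewrite card_Fp // => xp.
  by rewrite exprS xp -expr2 subrr.
have yE : ((y : nat)%:Z)%:~R = y by rewrite -pmulrn natr_Zp.
exists (y : nat)%:Z; move/eqP: y4; rewrite mulf_eq0 => /orP[] y4;
  [left | right].
  by rewrite (dvdz_pcharf cF) rmorphB rmorphXn /= yE.
by rewrite (dvdz_pcharf cF) rmorphD rmorphXn /= yE.
Qed.

(* One of 2 and -2 is a square mod p, and -2 is not. *)
Lemma sqrt2_exists (p : nat) : prime p -> (p %% 8 = 7)%N ->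
  exists r : int, (p %| r ^+ 2 - 2)%Z.
Proof.
move=> pp p8; have [|r [h|h]] := sqrt_or_sqrtN 2 pp; [lia | by exists r |].
have [] := sqrtN2_mod pp _ h; lia.
Qed.

(* If n is a square mod p and n + 1 is not, then - (n + 1) is a square. *)
Lemma minus1_sum2sqr (p : nat) : prime p -> (p %% 4 = 3)%N ->
  exists a b : int, (p %| 1 + a ^+ 2 + b ^+ 2)%Z.
Proof.
move=> pp p4.
suff /(_ p.-2)[//|[a ha]] : forall n : nat,
    (exists a b : int, (p %| 1 + a ^+ 2 + b ^+ 2)%Z) \/
    (exists a : int, (p %| a ^+ 2 - n.+1%:Z)%Z).
  (* At [n = p - 2] the second alternative makes [p - 1], that is -1, a square. *)
  exists a, 0; have p1 := prime_gt1 pp.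
  have -> : 1 + a ^+ 2 + 0 ^+ 2 = a ^+ 2 - p.-2.+1%:Z + p%:Z by lia.
  by rewrite rpredD.
elim=> [|n [|[a ha]]]; [by right; exists 1; rewrite expr1n subrr dvdz0 |
  by left |].
have [r [hr|hr]] := sqrt_or_sqrtN n.+2%:Z pp p4; first by right; exists r.
left; exists a, r.
have -> : 1 + a ^+ 2 + r ^+ 2 = (a ^+ 2 - n.+1%:Z) + (r ^+ 2 + n.+2%:Z).
  by rewrite -(addn1 n.+1) PoszD; ring.
by rewrite rpredD.
Qed.

(** Gauss reduction: [a] is nonzero as 2 is not a square, and once [b] is reduced mod [a] with
    [|a| >= 2], the bound [|b'^2 - 2| < a^2] makes the other outer coefficient smaller than [a]. *)
Lemma binary_disc2 (a b c : int) : a * c - b ^+ 2 = -2 ->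
  exists x y, absz (a * x ^+ 2 + 2 * b * x * y + c * y ^+ 2)%R = 1%N.
Proof.
have sq2 (z : int) : z ^+ 2 <> 2.
  by move=> z2; have : -1 <= z <= 1 \/ 4 <= z ^+ 2; [nia | case; nia].
have [k] := ubnP (absz a); elim: k a b c => // k IH a b c hk d.
have a0 : a != 0.
  by apply/eqP => a0; apply: (sq2 b); move: d; rewrite a0 mul0r; lia.
have [a1|a1] := eqVneq (absz a) 1%N.
  by exists 1, 0; rewrite !(mulr0, expr0n, expr1n, addr0, mulr1).
have [t ht] : exists t, - `|a| <= 2 * (b - t * a) <= `|a|.
  have [|q hq] := @round_div b `|a|; first by rewrite normr_gt0.
  by exists (q * sgz a); rewrite -mulrA -abszEsg abszE; lia.
pose b' := b - t * a; pose c' := c - 2 * t * b + t ^+ 2 * a.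
have d' : c' * a - b' ^+ 2 = -2 by rewrite -d /c' /b'; ring.
have c'a : (absz c' < absz a)%N.
  rewrite -ltz_nat !abszE -(ltr_pM2r (x := `|a|)) ?normr_gt0 // -normrM.
  have -> : c' * a = b' ^+ 2 - 2 by rewrite -d'; ring.
  have a2 : 2 <= `|a| by lia.
  have : 4 * b' ^+ 2 <= `|a| ^+ 2 by rewrite -/b' in ht; clear -ht; nia.
  by have := sqr_ge0 b'; clear -a2; nia.
have [|x [y xy]] := IH c' b' a _ d'; first by lia.
exists (y - t * x), x; rewrite -[RHS]xy /c' /b'; congr absz; ring.
Qed.

(** With [r^2 - 2 = l p], the form with coefficients [p], [2 r], [l] takes a value 1 or -1, and [p]
    times it is a norm from Z[sqrt 2]. *)
Lemma prime7_norm2 (p : nat) : prime p -> (p %% 8 = 7)%N ->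
  exists u v : int, 0 < u /\ u ^+ 2 - 2 * v ^+ 2 = p.
Proof.
move=> pp p8; have [r /dvdzP[l rl]] := sqrt2_exists pp p8.
have [|x [y xy]] := @binary_disc2 p r l.
  by rewrite -[p%:Z * l]mulrC -rl; ring.
pose a := p%:Z * x + r * y.
have aE : a ^+ 2 - 2 * y ^+ 2 =
    p%:Z * (p%:Z * x ^+ 2 + 2 * r * x * y + l * y ^+ 2).
  transitivity (p%:Z ^+ 2 * x ^+ 2 + 2 * p%:Z * r * x * y
    + (r ^+ 2 - 2) * y ^+ 2).
    by rewrite /a; ring.
  by rewrite rl; ring.
have [u [v uv]] : exists u v : int, u ^+ 2 - 2 * v ^+ 2 = p.
  have [e|e] : p%:Z * x ^+ 2 + 2 * r * x * y + l * y ^+ 2 = 1 \/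
      p%:Z * x ^+ 2 + 2 * r * x * y + l * y ^+ 2 = - 1 by lia.
    by exists a, y; rewrite aE e mulr1.
  (* Multiplication by [1 + sqrt 2], of norm -1, corrects the sign. *)
  exists (a + 2 * y), (a + y).
  have -> : (a + 2 * y) ^+ 2 - 2 * (a + y) ^+ 2 = - (a ^+ 2 - 2 * y ^+ 2)
    by ring.
  by rewrite aE e; ring.
exists `|u|, v; rewrite real_normK ?num_real //; split=> //.
rewrite normr_gt0; apply/eqP => u0; move: uv; rewrite u0 expr0n.
by have := prime_gt0 pp; have := sqr_ge0 v; lia.
Qed.

(* If 1 + a^2 + b^2 = 2 r^2 - 1 = 0 mod p, then e^2 + 2 (x^2 + y^2 + z^2) is
   divisible by p on the lattice e = t4, x = t3, y = b t3 + a r t4 + p t1,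
   z = - a t3 + b r t4 + p t2, and its quotient by p has determinant 8 there. *)
Lemma prime7_1222 (p : nat) : prime p -> (p %% 8 = 7)%N ->
  exists e x y z : int, e ^+ 2 + 2 * (x ^+ 2 + y ^+ 2 + z ^+ 2) = p.
Proof.
move=> pp p8; have p0 : 0 < p%:Z by rewrite ltz_nat prime_gt0.
have [a [b /dvdzP[k abk]]] : exists a b : int, (p %| 1 + a ^+ 2 + b ^+ 2)%Z.
  by apply: minus1_sum2sqr => //; lia.
have [r [l rl]] : exists r l : int, 2 * r ^+ 2 = 1 + l * p%:Z.
  have [s /dvdzP[l sl]] := sqrt2_exists pp p8.
  have [h ph] : exists h : nat, p%:Z = 2 * h%:Z + 1 by exists p./2; lia.
  (* Since [h + 1] inverts 2 mod [p], this takes [r = s / 2], where [s^2 = 2]. *)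
  exists (s * (h%:Z + 1)), (l * (p%:Z + 1) * (h%:Z + 1) + 2 + p%:Z).
  transitivity ((s ^+ 2 - 2) * (2 * (h%:Z + 1)) * (h%:Z + 1)
    + (2 * (h%:Z + 1)) ^+ 2); first ring.
  have -> : 2 * (h%:Z + 1) = p%:Z + 1 by rewrite ph; ring.
  by rewrite sl; ring.
pose g := QForm4 (2 * p%:Z) 0 (2 * b) (2 * a * r)
  (2 * p%:Z) (- 2 * a) (2 * b * r) (2 * k) 0 (k + l * (k * p%:Z - 1)).
have gE t1 t2 t3 t4 : p%:Z * qeval g t1 t2 t3 t4 =
   t4 ^+ 2 + 2 * (t3 ^+ 2 + (b * t3 + a * r * t4 + p%:Z * t1) ^+ 2
     + (- a * t3 + b * r * t4 + p%:Z * t2) ^+ 2).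
  transitivity ((k * p%:Z) * (2 * t3 ^+ 2)
    + (k * p%:Z + (l * p%:Z) * (k * p%:Z - 1)) * t4 ^+ 2
    + 2 * p%:Z * (p%:Z * t1 ^+ 2 + p%:Z * t2 ^+ 2 + 2 * b * t1 * t3
      + 2 * a * r * t1 * t4 - 2 * a * t2 * t3 + 2 * b * r * t2 * t4)).
    by rewrite /qeval /=; ring.
  by rewrite -abk (_ : l * p%:Z = 2 * r ^+ 2 - 1); [ring | rewrite rl; ring].
have d3 : minor3 g = 8 * p%:Z.
  transitivity (8 * p%:Z * (k * p%:Z - a ^+ 2 - b ^+ 2)).
    by rewrite /minor3 /det3 /=; ring.
  by rewrite -abk; ring.
have d4 : disc4 g = 8.
  transitivity (8 * (k * p%:Z - a ^+ 2 - b ^+ 2) *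
      (k * p%:Z + (l * p%:Z) * (k * p%:Z - 1)
       - (2 * r ^+ 2) * (a ^+ 2 + b ^+ 2))).
    by rewrite /disc4 /minor3 /det3 /minor2 /=; ring.
  by rewrite -abk (_ : l * p%:Z = 2 * r ^+ 2 - 1); [ring | rewrite rl; ring].
have [|||n [[t1 [t2 [t3 [t4 tn]]]] n2]] := @hermite4 g _ _ _ d4.
- by rewrite /=; clear -p0; lia.
- by rewrite /minor2 /=; clear -p0; nia.
- by rewrite d3; clear -p0; lia.
have := gE t1 t2 t3 t4; rewrite tn {tn}.
move: t4 t3 (_ + p%:Z * t1) (_ + p%:Z * t2) => e x y z.
clear -n2 pp p8.
have [->|->] : n = 1 \/ n = 2 by clear -n2; lia.
  by rewrite mulr1 => ->; exists e, x, y, z.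
move=> e2.
have podd : exists h : int, p%:Z = 2 * h + 1.
  by exists (p %/ 2)%N; clear -p8; lia.
(* If y and z have the same parity, y^2 + z^2 is twice a sum of two squares. *)
have final e' x' y' z' w : p%:Z = x' ^+ 2 + 2 * e' ^+ 2 + y' ^+ 2 + z' ^+ 2 ->
    y' = z' + 2 * w ->
    exists e x y z : int, e ^+ 2 + 2 * (x ^+ 2 + y ^+ 2 + z ^+ 2) = p.
  by move=> -> ->; exists x', e', (z' + w), w; ring.
(* Here [2 p] is represented, so [e] is even; halving gives [p = 2 h^2 + x^2 + y^2 + z^2], and since
   [p] is odd, two of [x], [y], [z] are even or all three are odd. *)
have [[h eh]|[h eh]] := int_parity e; last by clear -e2 eh; lia.
have pE : p%:Z = 2 * h ^+ 2 + x ^+ 2 + y ^+ 2 + z ^+ 2.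
  by rewrite eh in e2; clear -e2; lia.
have [h0 ph] := podd.
have [[x1 xE]|[x1 xE]] := int_parity x; have [[y1 yE]|[y1 yE]] := int_parity y;
  have [[z1 zE]|[z1 zE]] := int_parity z;
  try (by exfalso; move: pE; rewrite ph xE yE zE; clear; lia);
  [ apply: (final h z x y (x1 - y1)) | apply: (final h y x z (x1 - z1))
  | apply: (final h x y z (y1 - z1)) | apply: (final h x y z (y1 - z1)) ];
  rewrite ?pE ?xE ?yE ?zE; ring.
Qed.

(** * The norm form of the dicyclic order *)

(* |f(w)|^2 = sqn a + twist a * sqrt 2 for f(w) = a0 + a1 w + a2 w^2 + a3 w^3,
   w a primitive 8th root of unity. *)
Definition twist (a : int4) : int :=
  let: (a0, a1, a2, a3) := a in a0 * a1 + a1 * a2 + a2 * a3 - a3 * a0.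

Definition norm8 (a b : int4) : int :=
  (sqn a + sqn b) ^+ 2 - 2 * (twist a + twist b) ^+ 2.

(* Multiplication of f(w) by w, where w^4 = -1. *)
Definition negashift (a : int4) : int4 :=
  let: (a0, a1, a2, a3) := a in (- a3, a0, a1, a2).

(* Multiplication of f(w) by the unit 1 + w - w^3 = 1 + sqrt 2. *)
Definition unit_mul (a : int4) : int4 :=
  let: (a0, a1, a2, a3) := a in
  (a0 - a3 + a1, a1 + a0 + a2, a2 + a1 + a3, a3 + a2 - a0).

Lemma norm8C a b : norm8 a b = norm8 b a.
Proof. by rewrite /norm8 (addrC (sqn a)) (addrC (twist a)). Qed.

Lemma norm8_negashiftl a b : norm8 (negashift a) b = norm8 a b.
Proof.
by case: a b => [[[? ?] ?] ?] [[[? ?] ?] ?]; rewrite /norm8 /=; ring.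
Qed.

Lemma norm8_negashiftr a b : norm8 a (negashift b) = norm8 a b.
Proof. by rewrite norm8C norm8_negashiftl norm8C. Qed.

Lemma norm8_unit_mul a b : norm8 (unit_mul a) (unit_mul b) = norm8 a b.
Proof.
have E c : sqn (unit_mul c) = 3 * sqn c + 4 * twist c.
  by case: c => [[[? ?] ?] ?] /=; ring.
have F c : twist (unit_mul c) = 2 * sqn c + 3 * twist c.
  by case: c => [[[? ?] ?] ?] /=; ring.
by rewrite /norm8 !E !F; ring.
Qed.

(** An even number of coordinates of [s] are odd, so they pair off by parity; permuting [s] and [a]
    together preserves both norms and the dot product. *)
Lemma sqn_even_pairing (s a : int4) : (exists h, sqn s = 2 * h) ->
  exists s0 w s2 w' a', [/\ sqn (s0, s0 + 2 * w, s2, s2 + 2 * w') = sqn s,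
    sqn a' = sqn a & dot4 (s0, s0 + 2 * w, s2, s2 + 2 * w') a' = dot4 s a].
Proof.
case: s a => [[[s0 s1] s2] s3] [[[a0 a1] a2] a3] [h sh].
suff : [\/ (exists w, s1 = s0 + 2 * w) /\ (exists w, s3 = s2 + 2 * w),
           (exists w, s2 = s0 + 2 * w) /\ (exists w, s3 = s1 + 2 * w) |
           (exists w, s3 = s0 + 2 * w) /\ (exists w, s2 = s1 + 2 * w)].
  case=> [] [[w ->] [w' ->]]; [exists s0, w, s2, w', (a0, a1, a2, a3)
    | exists s0, w, s1, w', (a0, a2, a1, a3)
    | exists s0, w, s1, w', (a0, a3, a1, a2)];
  by split=> //=; ring.
move: sh => /=.
have [[x0 e0]|[x0 e0]] := int_parity s0;
  have [[x1 e1]|[x1 e1]] := int_parity s1;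
  have [[x2 e2]|[x2 e2]] := int_parity s2;
  have [[x3 e3]|[x3 e3]] := int_parity s3;
  rewrite e0 e1 e2 e3 => sh; try (by exfalso; clear -sh; lia);
  clear; first [
    by constructor 1; split; [exists (x1 - x0) | exists (x3 - x2)]; ring
  | by constructor 2; split; [exists (x2 - x0) | exists (x3 - x1)]; ring
  | by constructor 3; split; [exists (x3 - x0) | exists (x2 - x1)]; ring ].
Qed.

Lemma norm2_7mod8_odd (u v k : int) : u ^+ 2 - 2 * v ^+ 2 = 8 * k + 7 ->
  (exists h, u = 2 * h + 1) /\ (exists h, v = 2 * h + 1).
Proof.
move=> uv; have [[h uh]|[h uh]] := int_parity u.
  by exfalso; rewrite uh in uv; clear -uv; lia.
split; first by exists h.
have [[h' vh]|//] := int_parity v; exfalso.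
have [w wE] := odd_sqr8 h.
by rewrite uh wE vh in uv; clear -uv; lia.
Qed.

Lemma prime7_norm8 (p : nat) : prime p -> (p %% 8 = 7)%N ->
  exists a b, norm8 a b = p.
Proof.
move=> pp p8.
have [u [v [u0 uv]]] := prime7_norm2 pp p8.
have [e [x [y [z exyz]]]] := prime7_1222 pp p8.
have [k pk] : exists k : int, p%:Z = 8 * k + 7.
  by exists (p %/ 8)%N; clear -p8; lia.
have [[h uh] [h' vh]] : (exists h, u = 2 * h + 1) /\ (exists h, v = 2 * h + 1).
  by apply: (@norm2_7mod8_odd u v k); rewrite uv.
have [h'' eh] : exists h, e = 2 * h + 1.
  have [[h'' eh]|//] := int_parity e; exfalso.
  by rewrite eh pk in exyz; clear -exyz; lia.
pose n := h - h''; have nE : u - e = 2 * n by rewrite uh eh /n; ring.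
have euE : (u + e) * (u - e) = 2 * (v ^+ 2 + (x ^+ 2 + y ^+ 2 + z ^+ 2)).
  have -> : (u + e) * (u - e) = u ^+ 2 - e ^+ 2 by ring.
  by clear -uv exyz; lia.
have [m0 n0] : 0 <= u + e /\ 0 <= n.
  have : 0 <= (u + e) * (u - e).
    by rewrite euE; clear; have := sqr_ge0 v; have := sqr_ge0 x;
       have := sqr_ge0 y; have := sqr_ge0 z; lia.
  by rewrite nE; clear -u0 nE; split; nia.
have [|d dm dn /and4P[dv _ _ _]|s [a [sm an sa]]] :=
  @quat_factor (u + e) n (v, x, y, z) m0 n0.
- by rewrite nE in euE; rewrite /=; clear -euE; lia.
(* A common divisor divides the odd [v], so it is odd and divides [u]; its square then divides the
   prime [p = u^2 - 2 v^2]. *)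
- have du : (d %| u)%Z.
    have d2u : (d %| 2 * u)%Z.
      have -> : 2 * u = (u + e) + n * 2 by clear -nE; lia.
      by rewrite rpredD // dvdz_mulr.
    move: dv; rewrite !dvdzE in d2u * => dv; move: d2u;
      rewrite abszM Gauss_dvdr //.
    have : odd (absz v) by clear -vh; lia.
    by case/dvdnP: dv => c ->; rewrite oddM coprimen2 => /andP[].
  have [u' uE] := dvdzP du; have [v' vE] := dvdzP dv.
  have : (absz d * absz d %| p)%N.
    rewrite -abszM -[p]/(absz p%:Z) -dvdzE -uv uE vE.
    by apply/dvdzP; exists (u' ^+ 2 - 2 * v' ^+ 2); ring.
  move=> ddp; have /(_ (absz d)) := (primeP pp).2.
  move/(_ (dvdn_trans (dvdn_mulr _ (dvdnn _)) ddp)) => /orP[/eqP//|/eqP dp].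
  by have := dvdn_leq (prime_gt0 pp) ddp; rewrite dp; have := prime_gt1 pp;
    clear; nia.
have [|s0 [w [s2 [w' [[[[a0 a1] a2] a3] [sE aE saE]]]]]] :=
  @sqn_even_pairing s a _.
  by exists (u - n); rewrite sm; clear -nE; lia.
have vE : dot4 s a = v.
  move: sa; case: (s) (a) => [[[? ?] ?] ?] [[[? ?] ?] ?] [<- _ _ _] /=; ring.
(* twist a = a1 (a2 + a0) + a3 (a2 - a0), hence a2 + a0 and a2 - a0 are the
   first two coordinates of s, and similarly for b. *)
exists (- w, a0, s0 + w, a1), (- w', a2, s2 + w', a3).
rewrite /norm8 -uv.
have -> : twist (- w, a0, s0 + w, a1) + twist (- w', a2, s2 + w', a3) = v.
  by rewrite -vE -saE /=; ring.
congr (_ ^+ 2 - _); apply: (mulfI (x := 2)) => //.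
transitivity (sqn (s0, s0 + 2 * w, s2, s2 + 2 * w') + 2 * sqn (a0, a1, a2, a3)).
  by rewrite /=; ring.
by rewrite sE aE sm an -nE; ring.
Qed.

(** * Normal forms modulo 2 for the arguments of the norm form *)

Definition cong2 (c a : int4) : Prop := exists s, a = add4 c (scale4 2 s).

Lemma cong2_bits (a : int4) :
  exists b0 b1 b2 b3 : bool, cong2 (b0%:Z, b1%:Z, b2%:Z, b3%:Z) a.
Proof.
have bit (x : int) : exists (b : bool) h, x = b%:Z + 2 * h.
  by have [[h ->]|[h ->]] := int_parity x; [exists false | exists true];
    exists h; rewrite ?add0r // addrC.
case: a => [[[a0 a1] a2] a3].
have [b0 [h0 ->]] := bit a0; have [b1 [h1 ->]] := bit a1.
have [b2 [h2 ->]] := bit a2; have [b3 [h3 ->]] := bit a3.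
by exists b0, b1, b2, b3, (h0, h1, h2, h3).
Qed.

Lemma cong2_dvd4 (c a : int4) : dvd4 2 (add4 a (scale4 (-1) c)) -> cong2 c a.
Proof.
case: c a => [[[c0 c1] c2] c3] [[[a0 a1] a2] a3] /=.
case/and4P=> /dvdzP[s0 e0] /dvdzP[s1 e1] /dvdzP[s2 e2] /dvdzP[s3 e3].
by exists (s0, s1, s2, s3) => /=; congr (_, _, _, _); lia.
Qed.

Lemma cong2_negashift c a : cong2 c a -> cong2 (negashift c) (negashift a).
Proof.
case=> s ->; exists (negashift s).
by case: c s => [[[? ?] ?] ?] [[[? ?] ?] ?] /=; congr (_, _, _, _); ring.
Qed.

Lemma cong2_unit_mul c a : cong2 c a -> cong2 (unit_mul c) (unit_mul a).
Proof.
case=> s ->; exists (unit_mul s).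
by case: c s => [[[? ?] ?] ?] [[[? ?] ?] ?] /=; congr (_, _, _, _); ring.
Qed.

Lemma cong2_trans c d a : cong2 c d -> cong2 d a -> cong2 c a.
Proof.
case=> s -> [t ->]; exists (add4 s t).
case: c s t => [[[? ?] ?] ?] [[[? ?] ?] ?] [[[? ?] ?] ?] /=.
by congr (_, _, _, _); ring.
Qed.

Lemma cong2_sqn c a : cong2 c a -> exists h, sqn a = sqn c + 2 * h.
Proof.
case=> s ->; exists (2 * dot4 c s + 2 * sqn s).
by rewrite sqn_addZ; ring.
Qed.

Lemma cong2_twist c a : cong2 c a -> exists h, twist a = twist c + 2 * h.
Proof.
case=> s ->; case: c s => [[[c0 c1] c2] c3] [[[s0 s1] s2] s3] /=.
exists (c0 * s1 + s0 * c1 + 2 * s0 * s1 + c1 * s2 + s1 * c2 + 2 * s1 * s2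
  + c2 * s3 + s2 * c3 + 2 * s2 * s3 - c3 * s0 - s3 * c0 - 2 * s3 * s0).
by ring.
Qed.

(** Mod 2, [negashift] is a cyclic shift, and a vector with one or three odd coordinates is a shift
    of (1, 0, 0, 0) or (1, 1, 0, 1). *)
Lemma normalize_odd (a : int4) : (exists h, sqn a = 2 * h + 1) ->
  (exists h, twist a = 2 * h) /\
  exists (t : bool) a', cong2 (1, t%:Z, 0, t%:Z) a' /\
    forall b, norm8 a' b = norm8 a b.
Proof.
case=> h ah; have [b0 [b1 [b2 [b3 ca]]]] := cong2_bits a.
have [h1 sa] := cong2_sqn ca; have [h2 ta] := cong2_twist ca.
have c1 := cong2_negashift ca; have c2 := cong2_negashift c1.
have c3 := cong2_negashift c2; move: ta; rewrite ah in sa.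
have [[h3 ->]|[h3 ->]] := int_parity (twist a);
  move: sa ca c1 c2 c3; case: b0 b1 b2 b3 => [] [] [] [] /= sa ca c1 c2 c3 ta;
  try (by exfalso; clear -sa ta; lia).
all: split; first by exists h3.
all: clear -ca c1 c2 c3.
all: have pick (t : bool) s a' :
    dvd4 2 (add4 s (scale4 (-1) (1, t%:Z, 0, t%:Z))) -> cong2 s a' ->
    (forall b, norm8 a' b = norm8 a b) ->
    exists (t : bool) a', cong2 (1, t%:Z, 0, t%:Z) a' /\
      forall b, norm8 a' b = norm8 a b
  by move=> ts sa' E; exists t, a'; split=> //; apply: cong2_trans sa';
     apply: cong2_dvd4.
all: first [ by apply: (pick false _ _ _ ca) | by apply: (pick true _ _ _ ca)
  | by apply: (pick false _ _ _ c1) => // b; rewrite !norm8_negashiftl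
  | by apply: (pick true _ _ _ c1) => // b; rewrite !norm8_negashiftl
  | by apply: (pick false _ _ _ c2) => // b; rewrite !norm8_negashiftl
  | by apply: (pick true _ _ _ c2) => // b; rewrite !norm8_negashiftl
  | by apply: (pick false _ _ _ c3) => // b; rewrite !norm8_negashiftl
  | by apply: (pick true _ _ _ c3) => // b; rewrite !norm8_negashiftl ].
Qed.

(** Among residues with an even number of odd coordinates, [twist] is odd only for two cyclically
    adjacent ones. *)
Lemma normalize_even (a : int4) : (exists h, sqn a = 2 * h) ->
  (exists h, twist a = 2 * h + 1) ->
  exists a', cong2 (1, 1, 0, 0) a' /\ forall b, norm8 a' b = norm8 a b.
Proof.
case=> h ah [h3 ta']; have [b0 [b1 [b2 [b3 ca]]]] := cong2_bits a.
have [h1 sa] := cong2_sqn ca; have [h2 ta] := cong2_twist ca.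
have c1 := cong2_negashift ca; have c2 := cong2_negashift c1.
have c3 := cong2_negashift c2; move: sa ta ca c1 c2 c3; rewrite ah ta'.
case: b0 b1 b2 b3 => [] [] [] [] /= sa ta ca c1 c2 c3;
  try (by exfalso; clear -sa ta; lia).
all: have pick s a' : dvd4 2 (add4 s (scale4 (-1) (1, 1, 0, 0))) ->
    cong2 s a' -> (forall b, norm8 a' b = norm8 a b) ->
    exists a', cong2 (1, 1, 0, 0) a' /\ forall b, norm8 a' b = norm8 a b
  by move=> ts sa' E; exists a'; split=> //; apply: cong2_trans sa';
     apply: cong2_dvd4.
all: first [ by apply: (pick _ _ _ ca)
  | by apply: (pick _ _ _ c1) => // b; rewrite !norm8_negashiftl
  | by apply: (pick _ _ _ c2) => // b; rewrite !norm8_negashiftl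
  | by apply: (pick _ _ _ c3) => // b; rewrite !norm8_negashiftl ].
Qed.

(** Oddness of [u] and [v] in [p = u^2 - 2 v^2] makes one argument of odd norm and the other of even
    norm with odd [twist]. Both values of [t] serve later, for multipliers 5 and 13 mod 16. *)
Lemma prime7_norm8_normal (p : nat) (t : bool) : prime p -> (p %% 8 = 7)%N ->
  exists a b, [/\ cong2 (1, t%:Z, 0, t%:Z) a, cong2 (1, 1, 0, 0) b &
                norm8 a b = p].
Proof.
move=> pp p8; have [a0 [b0 E0]] := prime7_norm8 pp p8.
have [k pk] : exists k : int, p%:Z = 8 * k + 7.
  by exists (p %/ 8)%N; clear -p8; lia.
have [[h su] [h' tv]] := norm2_7mod8_odd (etrans E0 pk).
have [a [b [E [h1 sa] [h2 sb]]]] : exists a b, [/\ norm8 a b = p,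
    (exists h, sqn a = 2 * h + 1) & (exists h, sqn b = 2 * h)].
  have [[x ax]|[x ax]] := int_parity (sqn a0).
    exists b0, a0; split; [by rewrite norm8C | | by exists x].
    by exists (h - x); clear -ax su; lia.
  exists a0, b0; split=> //; first by exists x.
  by exists (h - x); clear -ax su; lia.
have [[w sE] [w' tE]] := norm2_7mod8_odd (etrans E pk).
have [[y ya] [t' [a' [ca aE]]]] := normalize_odd (ex_intro _ h1 sa).
have [|b' [cb bE]] := normalize_even (ex_intro _ h2 sb).
  by exists (w' - y); clear -ya tE; lia.
have E' : norm8 a' b' = p by rewrite aE norm8C bE norm8C.
have [<-|ntt] := eqVneq t' t; first by exists a', b'.
(* The unit exchanges the residues (1, 0, 0, 0) and (1, 1, 0, 1). *)
exists (unit_mul a'), (negashift (negashift (unit_mul b'))); split.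
- apply: cong2_trans (cong2_unit_mul ca).
  by apply: cong2_dvd4; case: t t' ntt {ca} => [] [].
- apply: cong2_trans (cong2_negashift (cong2_negashift (cong2_unit_mul cb))).
  exact: cong2_dvd4.
by rewrite !norm8_negashiftr norm8_unit_mul.
Qed.

(** * The group determinant *)

Lemma det_reindex (R : comNzRingType) (T : finType) n (s : 'I_n -> T)
    (M : T -> T -> R) : bijective s ->
  \det (\matrix_(i, j < #|T|) M (enum_val i) (enum_val j)) =
  \det (\matrix_(i, j < n) M (s i) (s j)).
Proof.
move=> bij_s; have := bij_eq_card bij_s; rewrite card_ord => nT.
move: s bij_s; rewrite nT => s bij_s; set A := \matrix_(i, j) _.
have inj : injective (fun i => enum_rank (s i)).
  by move=> i j /enum_rank_inj; apply: bij_inj.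
have -> : \matrix_(i, j) M (s i) (s j) =
    row_perm (perm inj) (col_perm (perm inj) A).
  by apply/matrixP=> i j; rewrite !mxE !permE !enum_rankK.
rewrite row_permE col_permE !det_mulmx !det_perm odd_permV.
by rewrite mulrCA -signr_addb addbb mulr1.
Qed.

(** A block triangular right factor clears the lower left block; its determinant, the product of the
    [d 0 i], is then cancelled. *)
Lemma det_block_diag_unit (R : idomainType) n (a b c d : 'rV[R]_n) :
  (forall i, d 0 i != 0) ->
  \det (block_mx (diag_mx a) (diag_mx b) (diag_mx c) (diag_mx d)) =
  \prod_i (a 0 i * d 0 i - b 0 i * c 0 i).
Proof.
move=> d0; set B := block_mx _ _ _ _.
pose e : 'rV[R]_n := \row_i (a 0 i * d 0 i - b 0 i * c 0 i).
have BE : B *m block_mx (diag_mx d) 0 (- diag_mx c) 1%:M =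
    block_mx (diag_mx e) (diag_mx b) 0 (diag_mx d).
  rewrite mulmx_block !mulmx0 !mulmx1 !add0r !mulmxN !mulmx_diag.
  congr block_mx; apply/matrixP=> i j; rewrite !mxE.
    by case: eqP => [->|]; rewrite ?mulr1n // !mulr0n subrr.
  by case: eqP => [->|]; rewrite ?mulr1n ?mulr0n ?[d _ _ * _]mulrC subrr.
have := congr1 determinant BE.
rewrite det_mulmx det_lblock det_ublock !det_diag det1 mulr1.
have dn0 : \prod_i d 0 i != 0 by apply/prodf_neq0 => i _.
by move/(mulIf dn0) => ->; apply: eq_bigr => i _; rewrite mxE.
Qed.

Lemma det_block_diag (R : idomainType) n (a b c d : 'rV[R]_n) :
  \det (block_mx (diag_mx a) (diag_mx b) (diag_mx c) (diag_mx d)) =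
  \prod_i (a 0 i * d 0 i - b 0 i * c 0 i).
Proof.
(* Deform d to d + X, which has no zero entry. *)
pose C := map_mx (@polyC R).
pose dX : 'rV[{poly R}]_n := \row_i ((d 0 i)%:P + 'X).
have dX0 i : dX 0 i != 0.
  rewrite mxE; apply/eqP => /(congr1 (fun p : {poly R} => p`_1)).
  by rewrite coefD coefC coefX coef0 add0r => /eqP; rewrite oner_eq0.
have := @det_block_diag_unit {poly R} n (C _ _ a) (C _ _ b) (C _ _ c) dX dX0.
move/(congr1 (horner_eval 0)); rewrite rmorph_prod -det_map_mx map_block_mx.
rewrite !map_diag_mx.
have ev m (x : 'rV[R]_m) : map_mx (horner_eval 0) (C _ _ x) = x.
  by apply/matrixP=> i j; rewrite !mxE /horner_eval hornerC.
have -> : map_mx (horner_eval 0) dX = d.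
  by apply/matrixP=> i j; rewrite !mxE /horner_eval hornerD hornerC hornerX
    addr0 !ord1.
rewrite !ev => ->; apply: eq_bigr => i _.
by rewrite !mxE rmorphB !rmorphM rmorphD /= /horner_eval !hornerC hornerX addr0.
Qed.

Definition eval8 (R : nzRingType) (f : 'I_8 -> R) (z : R) : R :=
  \sum_i f i * z ^+ i.

Lemma expr_ord8D (F : fieldType) (z : F) (i j : 'I_8) : z ^+ 8 = 1 ->
  z ^+ (i + j)%R = z ^+ i * z ^+ j.
Proof. by move=> z8; rewrite -exprD; exact: (expr_mod (i + j)%N z8). Qed.

Lemma expr_ord8N (F : fieldType) (z : F) (i : 'I_8) : z ^+ 8 = 1 ->
  z ^+ (- i)%R = z^-1 ^+ i.
Proof.
move=> z8; have z0 : z != 0 by apply: contra_eq_neq z8 => ->;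
  rewrite expr0n eq_sym oner_eq0.
apply: (mulfI (expf_neq0 i z0)).
by rewrite -expr_ord8D // subrr expr0 -exprMn divff ?expr1n.
Qed.

Lemma sum_eval8_sub (F : fieldType) (f : 'I_8 -> F) (z : F) (i : 'I_8) :
  z ^+ 8 = 1 ->
  \sum_j f (i - j) * z ^+ j = z ^+ i * eval8 f z^-1.
Proof.
move=> z8; rewrite (reindex_inj (inv_inj (subKr i))) mulr_sumr.
apply: eq_bigr => j _; rewrite subKr expr_ord8D // expr_ord8N //.
by rewrite mulrCA.
Qed.

Lemma sum_eval8_add (F : fieldType) (g : 'I_8 -> F) (z : F) (i : 'I_8) :
  z ^+ 8 = 1 ->
  \sum_j g (i + j) * z ^+ j = z^-1 ^+ i * eval8 g z.
Proof.
move=> z8; rewrite (reindex_inj (addrI (- i))) mulr_sumr.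
apply: eq_bigr => j _; rewrite addrA subrr add0r expr_ord8D // expr_ord8N //.
by rewrite mulrCA.
Qed.

(** The determinant of [f + g Y] in the representation induced from the character [X -> z]; the
    factor [z ^+ 4] comes from [Y^2 = X^4]. *)
Definition dicyclic_factor (F : fieldType) (f g : 'I_8 -> F) (z : F) : F :=
  eval8 f z * eval8 f z^-1 - z ^+ 4 * (eval8 g z * eval8 g z^-1).

(* Conjugation by the Fourier matrices of w and w^-1 makes all four blocks
   diagonal. *)
Lemma det_dicyclic (F : fieldType) (w : F) (f g : 'I_8 -> F) :
  8.-primitive_root w ->
  \det (block_mx (\matrix_(i, j) f (i - j)) (\matrix_(i, j) g (i + j + 4))
                 (\matrix_(i, j) g (i + j)) (\matrix_(i, j) f (i - j))) =
  \prod_(k < 8) dicyclic_factor f g (w ^+ k).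
Proof.
move=> w8.
pose zs := \row_(k < 8) w ^+ k; pose zi := \row_(k < 8) w ^- k.
have w81 := prim_expr_order w8.
have w0 : w != 0 by rewrite (prim_root_eq0 w8).
have z8 (k : 'I_8) : (w ^+ k) ^+ 8 = 1 by rewrite exprAC w81 expr1n.
have zi8 (k : 'I_8) : (w ^- k) ^+ 8 = 1 by rewrite exprVn z8 invr1.
pose V := Vandermonde 8 zs; pose V' := Vandermonde 8 zi.
have inj (i j : 'I_8) : w ^+ i = w ^+ j -> i = j.
  move/eqP; rewrite (eq_prim_root_expr w8) !modn_small // => /eqP;
    exact: val_inj.
have V0 : \det V * \det V' != 0.
  rewrite !det_Vandermonde mulf_neq0 //; apply/prodf_neq0 => i _;
    apply/prodf_neq0 => j; rewrite !mxE subr_eq0; apply: contraL => /eqP.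
    by move/inj ->; rewrite ltnn.
  by move/invr_inj/inj ->; rewrite ltnn.
set B := block_mx _ _ _ _.
pose a : 'rV_8 := \row_k eval8 f (w ^- k).
pose d : 'rV_8 := \row_k eval8 f (w ^+ k).
pose b : 'rV_8 := \row_k ((w ^+ k) ^+ 4 * eval8 g (w ^- k)).
pose c : 'rV_8 := \row_k eval8 g (w ^+ k).
(* Blocks in [i - j] preserve each Fourier vector up to a scalar, while blocks in [i + j] exchange
   those of [w ^+ k] and [w ^- k]; hence the two Vandermonde matrices. *)
have BE : B *m block_mx V 0 0 V' = block_mx V 0 0 V' *m
    block_mx (diag_mx a) (diag_mx b) (diag_mx c) (diag_mx d).
  rewrite !mulmx_block !mulmx0 !mul0mx !addr0 !add0r.
  congr block_mx; apply/matrixP=> i k; rewrite mul_mx_diag !mxE.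
  - under eq_bigr do rewrite !mxE.
    by rewrite sum_eval8_sub.
  - under eq_bigr => j _ do rewrite !mxE -addrA [j + 4]addrC addrA.
    rewrite sum_eval8_add // invrK expr_ord8D //.
    by rewrite -mulrA.
  - under eq_bigr do rewrite !mxE.
    by rewrite sum_eval8_add.
  - under eq_bigr do rewrite !mxE.
    by rewrite sum_eval8_sub // invrK.
have := congr1 determinant BE.
rewrite !det_mulmx det_ublock mulrC => /(mulfI V0) ->.
rewrite det_block_diag; apply: eq_bigr => k _; rewrite !mxE /dicyclic_factor;
  ring.
Qed.

(** * The determinant as an explicit integral form *)

Definition sum4 (c : int4) : int :=
  let: (c0, c1, c2, c3) := c in c0 + c1 + c2 + c3.

Definition alt4 (c : int4) : int :=
  let: (c0, c1, c2, c3) := c in c0 - c1 + c2 - c3.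

Definition gauss4 (c : int4) : int :=
  let: (c0, c1, c2, c3) := c in (c0 - c2) ^+ 2 + (c1 - c3) ^+ 2.

(* For f + g Y in Z[Q16], c and d are the residues of f and g modulo x^4 - 1,
   a and b those modulo x^4 + 1. *)
Definition q16_form (c d a b : int4) : int :=
  (sum4 c ^+ 2 - sum4 d ^+ 2) * (alt4 c ^+ 2 - alt4 d ^+ 2)
  * (gauss4 c - gauss4 d) ^+ 2 * norm8 a b ^+ 2.

Definition fold_add (f : 'I_8 -> int) : int4 :=
  (f 0 + f 4, f 1 + f 5, f 2 + f 6, f 3 + f 7).

Definition fold_sub (f : 'I_8 -> int) : int4 :=
  (f 0 - f 4, f 1 - f 5, f 2 - f 6, f 3 - f 7).

Lemma eval8E (R : comNzRingType) (f : 'I_8 -> int) (z : R) :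
  eval8 (fun i => (f i)%:~R) z =
  (f 0)%:~R + (f 1)%:~R * z + (f 2)%:~R * z ^+ 2 + (f 3)%:~R * z ^+ 3
  + (f 4)%:~R * z ^+ 4 + (f 5)%:~R * z ^+ 5 + (f 6)%:~R * z ^+ 6
  + (f 7)%:~R * z ^+ 7.
Proof.
rewrite /eval8 !big_ord_recl big_ord0 addr0 expr0 mulr1 !addrA.
by do !congr (_ + _); congr ((f _)%:~R * _); apply: val_inj.
Qed.

(** When [z ^+ 4 = -1], [z - z ^+ 3] is a square root of 2. Its sign at [w] and [w^7] is opposite to
    that at [w^3] and [w^5], so these four factors multiply to the square of [norm8]. *)
Lemma prod_dicyclic_factor (F : fieldType) (w : F) (f g : 'I_8 -> int) :
  8.-primitive_root w ->
  \prod_(k < 8)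
    dicyclic_factor (fun i => (f i)%:~R) (fun i => (g i)%:~R) (w ^+ k)
  = (q16_form (fold_add f) (fold_add g) (fold_sub f) (fold_sub g))%:~R.
Proof.
move=> w8; have w81 := prim_expr_order w8.
have w4 : w ^+ 4 = -1.
  have : (w ^+ 4) ^+ 2 == 1 by rewrite -exprM w81.
  rewrite sqrf_eq1 => /orP[|/eqP//].
  by rewrite -(prim_order_dvd w8).
set P := dicyclic_factor _ _.
set c := fold_add f; set d := fold_add g.
set a := fold_sub f; set b := fold_sub g.
have P1 : P 1 = (sum4 c ^+ 2 - sum4 d ^+ 2)%:~R.
  by rewrite /P /dicyclic_factor invr1 !eval8E /=; ring.
have PN1 : P (-1) = (alt4 c ^+ 2 - alt4 d ^+ 2)%:~R.
  by rewrite /P /dicyclic_factor invrN1 !eval8E /=; ring.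
have Pi z : z ^+ 2 = -1 -> P z = (gauss4 c - gauss4 d)%:~R.
  move=> z2; have zV : z^-1 = - z.
    by apply: mulr1_eq; rewrite mulrN -expr2 z2 opprK.
  by rewrite /P /dicyclic_factor zV !eval8E /=; ring: z2.
have P8 z : z ^+ 4 = -1 ->
    P z = (sqn a + sqn b)%:~R + (twist a + twist b)%:~R * (z - z ^+ 3).
  move=> z4; have zV : z^-1 = - z ^+ 3.
    by apply: mulr1_eq; rewrite mulrN -exprS z4 opprK.
  by rewrite /P /dicyclic_factor zV !eval8E /=; ring: z4.
rewrite !big_ord_recl big_ord0 mulr1 /bump /= expr0 expr1.
have e m n : (m * n %% 8 = 4)%N -> (w ^+ m) ^+ n = -1.
  by move=> mn; rewrite -exprM -(expr_mod _ w81) mn.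
rewrite P1 w4 PN1 (P8 w w4) (Pi _ (e 2 2 erefl)) (Pi _ (e 6 2 erefl)).
rewrite (P8 _ (e 3 4 erefl)) (P8 _ (e 5 4 erefl)) (P8 _ (e 7 4 erefl)).
by rewrite /q16_form /norm8; ring: w4.
Qed.

(** * From the presentation to the coefficients *)

Lemma card_Q16 (gT : finGroupType) : Q16_presentation gT -> #|gT| = 16%N.
Proof.
move=> isoG; have isoQ := Q16_presentationP.
have cQ : #|[set: 'Q_16]| = 16%N := @card_quaternion 4 isT.
(* Sharing a presentation, each group is a homomorphic image of the other, so the orders divide each
   other. *)
have GQ : ([set: gT] \homg [set: 'Q_16])%g.
  by rewrite (isoQ _ [set: gT]%G) -(isoG _ [set: gT]%G) homg_refl.
have QG : ([set: 'Q_16] \homg [set: gT])%g.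
  by rewrite (isoG _ [set: 'Q_16]%G) -(isoQ _ [set: 'Q_16]%G) homg_refl.
by rewrite -cardsT -cQ; apply/eqP; rewrite eqn_dvd !card_homg.
Qed.

(** Listing the powers of [x] before their products with [y] turns the group matrix into the block
    matrix of [det_dicyclic]. *)
Definition dicyclic_elt (gT : finGroupType) (x y : gT) (i : 'I_(8 + 8)) : gT :=
  match split i with inl j => (x ^+ j)%g | inr j => (x ^+ j * y)%g end.

Lemma Q16_generators (gT : finGroupType) : Q16_presentation gT ->
  exists x y : gT, [/\ x ^+ 8 = 1, y ^+ 2 = x ^+ 4, x * y = y * x^-1
    & bijective (dicyclic_elt x y)]%g.
Proof.
move=> isoG; have := isoG _ [set: gT]%G; rewrite homg_refl.
move=> /esym/existsP[[x y]] /=.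
rewrite !xpair_eqE => /and4P[/eqP defG /eqP x8 /eqP y2 /eqP xy]; exists x, y.
have nxy : (<[y]> \subset 'N(<[x]>))%g.
  by rewrite norms_cycle conjgE xy mulKg groupV cycle_id.
have surj z : z \in codom (dicyclic_elt x y).
  have := in_setT z.
  rewrite -defG norm_joinEr // => /mulsgP[_ _ /cycleP[i ->] /cycleP[j ->] ->].
  have -> : (x ^+ i * y ^+ j =
             x ^+ ((i + 4 * (j %/ 2)) %% 8) * y ^+ (j %% 2))%g.
    rewrite expg_mod // expgD expgM -y2 -expgM -mulgA -expgD mulnC.
    by rewrite -divn_eq.
  set k := (_ %% 8)%N; have k8 : (k < 8)%N by rewrite ltn_mod.
  have [j0|j1] : (j %% 2 = 0)%N \/ (j %% 2 = 1)%N by clear; lia.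
    apply/codomP; exists (lshift 8 (Ordinal k8)).
    by rewrite /dicyclic_elt (unsplitK (inl _)) j0 mulg1.
  apply/codomP; exists (rshift 8 (Ordinal k8)).
  by rewrite /dicyclic_elt (unsplitK (inr _)) j1 expg1.
split=> //; apply: inj_card_bij; last by rewrite card_Q16 // card_ord.
have /image_injP inj : #|codom (dicyclic_elt x y)| == #|'I_(8 + 8)|.
  have -> : #|'I_(8 + 8)| = #|gT| by rewrite card_ord card_Q16.
  apply/eqP/eq_card => z.
  by rewrite surj.
by move=> i j; apply: inj.
Qed.

Lemma group_det_Q16 (gT : finGroupType) (x y : gT) (a : {ffun gT -> int}) :
  (x ^+ 8 = 1)%g -> (y ^+ 2 = x ^+ 4)%g -> (x * y = y * x^-1)%g ->
  bijective (dicyclic_elt x y) ->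
  let f (i : 'I_8) := a (x ^+ i)%g in let g (i : 'I_8) := a (x ^+ i * y)%g in
  group_det a = q16_form (fold_add f) (fold_add g) (fold_sub f) (fold_sub g).
Proof.
move=> x8 y2 xy bij f g; rewrite /group_det /group_mx.
rewrite (det_reindex (fun u v : gT => a (u * v^-1)%g) bij).
have [w w8] := @C_prim_root_exists 8 isT.
apply: (@intr_inj algC).
rewrite -(prod_dicyclic_factor _ _ w8) -det_dicyclic //.
rewrite -det_map_mx; congr determinant.
have yx n : (y * x ^- n = x ^+ n * y)%g.
  elim: n => [|n IH]; first by rewrite !expg0 invg1 mulg1 mul1g.
  by rewrite expgSr invMg mulgA -xy -mulgA IH mulgA -expgS expgSr.
have [z zE yV] : exists2 z, z = (x ^+ 4)%g & (y^-1 = z * y)%g.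
  by exists (x ^+ 4)%g => //; apply/eqP;
    rewrite eq_invg_mul -y2 -expgSr -expgS (expgM _ 2 2) y2 -expgM x8.
have xD (i j : 'I_8) : (x ^+ (i + j)%R = x ^+ i * x ^+ j)%g.
  by rewrite -expgD; exact: (expg_mod (i + j) x8).
have xN (i : 'I_8) : (x ^+ (- i)%R = x ^- i)%g.
  by apply/esym/eqP; rewrite eq_invg_mul -xD subrr.
apply/matrixP=> i j; rewrite !mxE /dicyclic_elt.
case: (split i) => k; rewrite !mxE; case: (split j) => l; rewrite !mxE;
  congr (_%:~R).
- by rewrite /f xD xN.
- rewrite /g 2!xD -[(x ^+ (4%R : 'I_8))%g]zE invMg yV -[(z * y * _)%g]mulgA yx.
  by rewrite -!mulgA [(z * (_ * _))%g]mulgA zE -!expgD addnC expgD !mulgA.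
- by rewrite /g xD -mulgA yx mulgA.
by rewrite /f xD xN invMg mulgA mulgK.
Qed.

(** The differences [fold_sub f] and the upper four coefficients of [f] are free parameters, and
    [fold_add f] is the former plus twice the latter. *)
Lemma int_group_det_Q16P (gT : finGroupType) (n : int) : Q16_presentation gT ->
  int_group_det gT n <-> exists a b s t : int4,
    n = q16_form (add4 a (scale4 2 s)) (add4 b (scale4 2 t)) a b.
Proof.
move=> isoG; have [x [y [x8 y2 xy bij]]] := Q16_generators isoG.
split=> [[a <-]|[[[[a0 a1] a2] a3] [[[[b0 b1] b2] b3]]]].
  have := group_det_Q16 a x8 y2 xy bij.
  set f := fun i : 'I_8 => _; set g := fun i : 'I_8 => _ => ->.
  exists (fold_sub f), (fold_sub g), (f 4, f 5, f 6, f 7), (g 4, g 5, g 6, g 7).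
  by congr q16_form; congr (_, _, _, _); ring.
case=> -[[[s0 s1] s2] s3] [[[[t0 t1] t2] t3] ->].
have [r rK Kr] := bij.
pose F := [:: a0 + s0; a1 + s1; a2 + s2; a3 + s3; s0; s1; s2; s3].
pose G := [:: b0 + t0; b1 + t1; b2 + t2; b3 + t3; t0; t1; t2; t3].
exists [ffun z => match split (r z) with inl j => F`_j | inr j => G`_j end].
rewrite (group_det_Q16 _ x8 y2 xy bij).
have fE (j : 'I_8) : r (x ^+ j)%g = lshift 8 j.
  by rewrite -[RHS]rK /dicyclic_elt (unsplitK (inl j)).
have gE (j : 'I_8) : r (x ^+ j * y)%g = rshift 8 j.
  by rewrite -[RHS]rK /dicyclic_elt (unsplitK (inr j)).
rewrite /fold_add /fold_sub !ffunE !fE !gE.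
rewrite !(unsplitK (inl _)) !(unsplitK (inr _)) /=.
by congr q16_form; congr (_, _, _, _); ring.
Qed.

(** * Values of the determinant form *)

(* With X = a0^2 + a2^2 + b0^2 + b2^2, Y = a1^2 + a3^2 + b1^2 + b3^2 and s as
   below, |s|^2 Y = 2 X Y is the norm of a quaternion with real part v, and
   norm8 a b = (X - Y)^2 + 2 (2 X Y - v^2). *)
Lemma norm8_ge0 a b : 0 <= norm8 a b.
Proof.
case: a b => [[[a0 a1] a2] a3] [[[b0 b1] b2] b3].
pose s := (a2 + a0, a2 - a0, b2 + b0, b2 - b0).
have [x [y [z e]]] : exists x y z,
    qmul s (qconj (a1, a3, b1, b3)) =
    (twist (a0, a1, a2, a3) + twist (b0, b1, b2, b3), x, y, z).
  by do 3!eexists; rewrite /=; congr (_, _, _, _); ring.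
have := congr1 sqn e; rewrite sqn_qmul sqn_qconj /norm8.
move: (_ + _) => v /= vE.
have -> : (sqn (a0, a1, a2, a3) + sqn (b0, b1, b2, b3)) ^+ 2 - 2 * v ^+ 2 =
  (a0 ^+ 2 + a2 ^+ 2 + b0 ^+ 2 + b2 ^+ 2
   - a1 ^+ 2 - a3 ^+ 2 - b1 ^+ 2 - b3 ^+ 2) ^+ 2
  + 2 * (v ^+ 2 + x ^+ 2 + y ^+ 2 + z ^+ 2 - v ^+ 2) by rewrite -vE /=; ring.
rewrite addr_ge0 ?sqr_ge0 // mulr_ge0 //; clear.
by have := sqr_ge0 x; have := sqr_ge0 y; have := sqr_ge0 z; lia.
Qed.

Lemma q16_formC c d a b : q16_form c d a b = q16_form d c b a.
Proof. by rewrite /q16_form norm8C; ring. Qed.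

Lemma sqr_parity (x : int) : exists w, x ^+ 2 = x + 2 * w.
Proof.
have [[w ->]|[w ->]] := int_parity x; first by exists (2 * w ^+ 2 - w); ring.
by exists (2 * w ^+ 2 + w); ring.
Qed.

Lemma odd_mul (x y : int) :
  (exists h, x = 2 * h + 1) -> (exists h, y = 2 * h + 1) ->
  exists h, x * y = 2 * h + 1.
Proof. by case=> [h ->] [h' ->]; exists (2 * h * h' + h + h'); ring. Qed.

(* P = c0 + c2 and Q = c1 + c3; modulo 2 these are a0 + a2 and a1 + a3. *)
Lemma residue_parities (a s : int4) : let c := add4 a (scale4 2 s) in
  exists P Q h1 h2 h3, [/\ sum4 c = P + Q, alt4 c = P - Q,
    gauss4 c = P ^+ 2 + Q ^+ 2 + 4 * h1, sqn a = P + Q + 2 * h2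
    & twist a = P * Q + 2 * h3].
Proof.
case: a s => [[[a0 a1] a2] a3] [[[s0 s1] s2] s3] /=.
have [w0 e0] := sqr_parity a0; have [w1 e1] := sqr_parity a1.
have [w2 e2] := sqr_parity a2; have [w3 e3] := sqr_parity a3.
exists (a0 + a2 + 2 * (s0 + s2)), (a1 + a3 + 2 * (s1 + s3)).
exists (- ((a0 + 2 * s0) * (a2 + 2 * s2) + (a1 + 2 * s1) * (a3 + 2 * s3))).
exists (w0 + w1 + w2 + w3 - (s0 + s1 + s2 + s3)).
exists (- (a0 * a3 + (a0 + a2) * (s1 + s3) + (a1 + a3) * (s0 + s2)
  + 2 * (s0 + s2) * (s1 + s3))).
by split; rewrite ?e0 ?e1 ?e2 ?e3; ring.
Qed.

Lemma odd_parts (P Q P' Q' h1 h2 v m : int) : P + Q + P' + Q' = 2 * m + 1 ->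
  [/\ exists h, (P + Q) ^+ 2 - (P' + Q') ^+ 2 = 2 * h + 1,
      exists h, (P - Q) ^+ 2 - (P' - Q') ^+ 2 = 2 * h + 1,
      exists h, P ^+ 2 + Q ^+ 2 - (P' ^+ 2 + Q' ^+ 2) + 4 * h1 = 2 * h + 1
    & exists h, (P + Q + P' + Q' + 2 * h2) ^+ 2 - 2 * v ^+ 2 = 2 * h + 1].
Proof.
move=> mE; have [w e] := sqr_parity P; have [z f] := sqr_parity Q.
have [w' e'] := sqr_parity P'; have [z' f'] := sqr_parity Q'.
have -> : P + Q + P' + Q' + 2 * h2 = 2 * (m + h2) + 1 by rewrite mE; ring.
have Q'E : Q' = 2 * m + 1 - P - Q - P' by rewrite -mE; ring.
split.
- by exists ((P + Q) * (2 * m + 1) - 2 * m ^+ 2 - 2 * m - 1); rewrite Q'E; ring.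
- by exists (2 * (m - Q - P') * (P + P' - m - 1) + (m - Q - P')
    + (P + P' - m - 1)); rewrite Q'E; ring.
- exists (w + z - w' - z' + 2 * h1 + P + Q - m - 1).
  by rewrite e f e' f' Q'E; ring.
by exists (2 * (m + h2) ^+ 2 + 2 * (m + h2) - v ^+ 2); ring.
Qed.

(** If [P + Q + P' + Q'] is odd, so are all four factors. Otherwise [C] and [N] are even, and it
    suffices that 64 divides [A * B], or that 16 divides it and 4 divides [C] and [N]. *)
Lemma even_value (P Q P' Q' h1 h2 h3 k : int) :
  let A := (P + Q) ^+ 2 - (P' + Q') ^+ 2 in
  let B := (P - Q) ^+ 2 - (P' - Q') ^+ 2 in
  let C := P ^+ 2 + Q ^+ 2 - (P' ^+ 2 + Q' ^+ 2) + 4 * h1 in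
  let N := (P + Q + P' + Q' + 2 * h2) ^+ 2
           - 2 * (P * Q + P' * Q' + 2 * h3) ^+ 2 in
  A * B * C ^+ 2 * N ^+ 2 = 2 * k ->
  exists w, A * B * C ^+ 2 * N ^+ 2 = 1024 * w.
Proof.
move=> A B C N evk.
have [[m mE]|[m mE]] := int_parity (P + Q + P' + Q'); last first.
  have [oA oB oC oN] := odd_parts h1 h2 (P * Q + P' * Q' + 2 * h3) mE.
  have := odd_mul (odd_mul (odd_mul oA oB) (odd_mul oC oC)) (odd_mul oN oN).
  by case=> h; rewrite -!expr2 -/A -/B -/C -/N evk; clear; lia.
clear evk k.
have sum3 i j t l : A * B = 64 * i -> C = 2 * j -> N = 2 * t ->
    l = 1024 * (i * j ^+ 2 * t ^+ 2) -> A * B * C ^+ 2 * N ^+ 2 = l.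
  by move=> -> -> -> ->; ring.
have all4 i j t l : A * B = 16 * i -> C = 4 * j -> N = 4 * t ->
    l = 1024 * (4 * i * j ^+ 2 * t ^+ 2) -> A * B * C ^+ 2 * N ^+ 2 = l.
  by move=> -> -> -> ->; ring.
have C2 : exists j, C = 2 * j.
  have [w e] := sqr_parity P; have [z f] := sqr_parity Q.
  have [w' e'] := sqr_parity P'; have [z' f'] := sqr_parity Q'.
  exists (w + z - w' - z' + 2 * h1 + P + Q - m).
  rewrite /C e f e' f'.
  by rewrite (_ : Q' = 2 * m - P - Q - P'); [ring | rewrite -mE; ring].
have N2 : exists t, N = 2 * t.
  by exists (2 * (m + h2) ^+ 2 - (P * Q + P' * Q' + 2 * h3) ^+ 2);
    rewrite /N mE; ring.
have [j Cj] := C2; have [t Nt] := N2; clear C2 N2.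
suff [[i AB]|[i [j' [t' [AB C4 N4]]]]] : (exists i, A * B = 64 * i) \/
    exists i j t, [/\ A * B = 16 * i, C = 4 * j & N = 4 * t].
- by eexists; apply: sum3 AB Cj Nt erefl.
- by eexists; apply: all4 AB C4 N4 erefl.
clear j Cj t Nt sum3 all4.
(* If [P + Q] is odd, [A] and [B] are differences of odd squares, each divisible by 8. *)
have [[f fE]|[f fE]] := int_parity (P + Q); last first.
  have [w1 e1] := odd_sqr8 f; have [w2 e2] := odd_sqr8 (m - f - 1).
  have [w3 e3] := odd_sqr8 (f - Q); have [w4 e4] := odd_sqr8 (m - f - 1 - Q').
  left; exists ((w1 - w2) * (w3 - w4)); rewrite /A /B.
  have -> : P' + Q' = 2 * (m - f - 1) + 1 by clear -mE fE; lia.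
  have -> : P' - Q' = 2 * (m - f - 1 - Q') + 1 by clear -mE fE; lia.
  have -> : P - Q = 2 * (f - Q) + 1 by clear -fE; lia.
  by rewrite fE e1 e2 e3 e4; ring.
have PE : P = 2 * f - Q by clear -fE; lia.
have P'E : P' = 2 * (m - f) - Q' by clear -mE fE; lia.
have AE : A = 4 * (f ^+ 2 - (m - f) ^+ 2) by rewrite /A PE P'E; ring.
have BE : B = 4 * ((f - Q) ^+ 2 - (m - f - Q') ^+ 2) by rewrite /B PE P'E; ring.
(* In [A / 4] and [B / 4] the squared terms have roots summing to [m] and [m - Q - Q']. If [Q + Q']
   is odd, one sum is even and that difference of squares is divisible by 4. *)
have [[q qE]|[q qE]] := int_parity (Q + Q'); last first.
  left; rewrite AE BE; have Q'E : Q' = 2 * q + 1 - Q by rewrite -qE; ring.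
  rewrite Q'E; have [[r ->]|[r ->]] := int_parity m.
    exists (r * (f - r)
      * ((f - Q) ^+ 2 - (2 * r - f - (2 * q + 1 - Q)) ^+ 2)).
    by ring.
  exists ((f ^+ 2 - (2 * r + 1 - f) ^+ 2) * ((r - q) * (f - Q - (r - q)))).
  by ring.
right; have Q'E : Q' = 2 * q - Q by rewrite -qE; ring.
exists ((f ^+ 2 - (m - f) ^+ 2) * ((f - Q) ^+ 2 - (m - f - Q') ^+ 2)).
exists (f ^+ 2 - f * Q - (m - f) ^+ 2 + (m - f) * Q' + 2 * q * (Q - q) + h1).
exists ((m + h2) ^+ 2 - 2 * (f * Q + (m - f) * Q' - Q ^+ 2
  + 2 * q * Q - 2 * q ^+ 2 + h3) ^+ 2).
split; first by rewrite AE BE; ring.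
  by rewrite /C PE P'E Q'E; ring.
by rewrite /N mE PE P'E Q'E; ring.
Qed.

Lemma q16_form_even (a b s t : int4) :
  let n := q16_form (add4 a (scale4 2 s)) (add4 b (scale4 2 t)) a b in
  (2 %| n)%Z -> (2 ^+ 10 %| n)%Z.
Proof.
have [P [Q [h1 [h2 [h3 [cs ca cg ua ta]]]]]] := residue_parities a s.
have [P' [Q' [h1' [h2' [h3' [ds da dg ub tb]]]]]] := residue_parities b t.
move=> n; have nE : n =
   ((P + Q) ^+ 2 - (P' + Q') ^+ 2) * ((P - Q) ^+ 2 - (P' - Q') ^+ 2)
   * (P ^+ 2 + Q ^+ 2 - (P' ^+ 2 + Q' ^+ 2) + 4 * (h1 - h1')) ^+ 2
   * ((P + Q + P' + Q' + 2 * (h2 + h2')) ^+ 2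
     - 2 * (P * Q + P' * Q' + 2 * (h3 + h3')) ^+ 2) ^+ 2.
  rewrite /n /q16_form /norm8 cs ca cg ds da dg ua ta ub tb.
  by do ![congr (_ * _) | congr (_ ^+ 2)]; ring.
case/dvdzP=> k nk; have [|w wE] :=
  @even_value P Q P' Q' (h1 - h1') (h2 + h2') (h3 + h3') k.
  by rewrite -nE nk mulrC.
by apply/dvdzP; exists w; rewrite nE wE mulrC.
Qed.

Lemma mul_1mod8 (x y : int) :
  (exists w, x = 8 * w + 1) -> (exists w, y = 8 * w + 1) ->
  exists w, x * y = 8 * w + 1.
Proof. by case=> [u ->] [v ->]; exists (8 * u * v + u + v); ring. Qed.

Definition q16_odd_value (n : int) : Prop :=
  (exists w, n = 8 * w + 1) \/
  exists (w m z : int) (p : nat), [/\ n = 8 * w + 5, m = 8 * z + 5, prime p,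
    (p %% 8 = 7)%N & n = m * p%:Z ^+ 2].

(** [A * B] is [1 + 4 * Q'] mod 8, while [C] and [N] are odd. For odd [Q'], [v] is odd too, so [N]
    is 7 mod 8 and, being nonnegative, has a prime factor 7 mod 8, whose square is split off. *)
Lemma q16_form_odd_half (a b s t : int4) :
  let c := add4 a (scale4 2 s) in let d := add4 b (scale4 2 t) in
  (exists f, sum4 c = 2 * f + 1) -> (exists g, sum4 d = 2 * g) ->
  q16_odd_value (q16_form c d a b).
Proof.
have [P [Q [h1 [h2 [h3 [cs ca cg ua ta]]]]]] := residue_parities a s.
have [P' [Q' [h1' [h2' [h3' [ds da dg ub tb]]]]]] := residue_parities b t.
move=> c d [f]; rewrite cs => fE [g]; rewrite ds => gE.
have N0 := norm8_ge0 a b.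
rewrite /q16_odd_value /q16_form cs ds ca da cg dg fE gE.
set C := _ + _ - _; pose u := sqn a + sqn b; pose v := twist a + twist b.
have NE : norm8 a b = u ^+ 2 - 2 * v ^+ 2 by [].
move: (norm8 a b) NE N0 => N NE N0.
have [w1 e1] := odd_sqr8 f; have [w2 e2] := odd_sqr8 (f - Q).
have [w3 e3] := sqr_parity g; have [w4 e4] := sqr_parity (g - Q').
have QP : P = 2 * f + 1 - Q by rewrite -fE; ring.
have QP' : P' = 2 * g - Q' by rewrite -gE; ring.
have ABE : ((2 * f + 1) ^+ 2 - (2 * g) ^+ 2) * ((P - Q) ^+ 2 - (P' - Q') ^+ 2) =
    (8 * (w1 - w3) + 1 - 4 * g) * (8 * (w2 - w4) + 1 - 4 * (g - Q')).
  have -> : P - Q = 2 * (f - Q) + 1 by rewrite QP; ring.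
  have -> : P' - Q' = 2 * (g - Q') by rewrite QP'; ring.
  by rewrite !exprMn e1 e2 e3 e4; ring.
have [k ABk] : exists k, ((2 * f + 1) ^+ 2 - (2 * g) ^+ 2) *
    ((P - Q) ^+ 2 - (P' - Q') ^+ 2) = 8 * k + 1 + 4 * Q'.
  rewrite ABE; exists ((8 * (w1 - w3) + 1 - 4 * g) * (w2 - w4) + (w1 - w3)
    - g - 4 * (w1 - w3) * (g - Q') + 2 * g * (g - Q')).
  by ring.
have uE : u = 2 * (f + g + h2 + h2') + 1.
  by rewrite /u ua ub fE gE; ring.
have [wC eC] : exists w, C ^+ 2 = 8 * w + 1.
  have [z1 i1] := sqr_parity P; have [z2 i2] := sqr_parity Q.
  have [z3 i3] := sqr_parity P'; have [z4 i4] := sqr_parity Q'.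
  have -> : C = 2 * (f - g + z1 + z2 - z3 - z4 + 2 * (h1 - h1')) + 1.
    by rewrite /C i1 i2 i3 i4 QP QP'; ring.
  exact: odd_sqr8.
have u2 : u ^+ 2 - 2 * v ^+ 2 = 2 * (2 * (f + g + h2 + h2') ^+ 2
     + 2 * (f + g + h2 + h2') - v ^+ 2) + 1 by rewrite uE; ring.
have [wN eN] : exists w, N ^+ 2 = 8 * w + 1 by rewrite NE u2; exact: odd_sqr8.
rewrite ABk.
have [[q qE]|[q qE]] := int_parity Q'; [left | right].
  rewrite qE; apply: mul_1mod8; last by exists wN.
  apply: mul_1mod8; last by exists wC.
  by exists (k + q); ring.
have vE : exists z, v = 2 * z + 1.
  have [wQ eQ] := sqr_parity Q.
  exists (f * Q - wQ + (2 * g - Q') * q + g - q - 1 + h3 + h3').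
  transitivity (2 * f * Q + Q - Q ^+ 2 + (2 * g - Q') * Q' + 2 * (h3 + h3')).
    by rewrite /v ta tb QP QP'; ring.
  by rewrite eQ qE; ring.
have [k' Nk] : exists k, u ^+ 2 - 2 * v ^+ 2 = 8 * k + 7.
  have [z ->] := vE; rewrite uE.
  have [i ->] := odd_sqr8 (f + g + h2 + h2'); have [i' ->] := odd_sqr8 z.
  by exists (i - 2 * i' - 1); ring.
have Npos : 0 < u ^+ 2 - 2 * v ^+ 2.
  by move: N0; rewrite NE Nk; clear; lia.
have [p [pp p7 pN]] := norm2_prime7 Npos (ex_intro _ _ Nk).
rewrite -NE in pN; have [r rE] := dvdzP pN.
have [h ph] : exists h : int, p%:Z = 8 * h + 7.
  by exists (p %/ 8)%N; clear -p7; lia.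
have [w nw] : exists w, (8 * k + 1 + 4 * Q') * C ^+ 2 * N ^+ 2 = 8 * w + 5.
  rewrite eC eN qE.
  exists ((8 * k + 1 + 4 * (2 * q + 1)) * (8 * wC * wN + wC + wN) + k + q);
    ring.
pose m := (8 * k + 1 + 4 * Q') * C ^+ 2 * r ^+ 2.
have nm : (8 * k + 1 + 4 * Q') * C ^+ 2 * N ^+ 2 = m * p%:Z ^+ 2.
  by rewrite rE /m; ring.
(* As [p^2 = 8 (8 h^2 + 14 h + 6) + 1], the residue of [m] mod 8 is that of [m p^2]. *)
exists w, m, (w - m * (8 * h ^+ 2 + 14 * h + 6)), p; split=> //.
move: nw; rewrite nm => mp.
transitivity (m * p%:Z ^+ 2 - 8 * (m * (8 * h ^+ 2 + 14 * h + 6))).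
  by rewrite ph; ring.
by rewrite mp; ring.
Qed.

Lemma q16_form_odd (a b s t : int4) :
  let n := q16_form (add4 a (scale4 2 s)) (add4 b (scale4 2 t)) a b in
  ~~ (2 %| n)%Z -> q16_odd_value n.
Proof.
move=> n n2; set c := add4 a _ in n n2 *; set d := add4 b _ in n n2 *.
have [[f fE]|[f fE]] := int_parity (sum4 c);
  have [[g gE]|[g gE]] := int_parity (sum4 d).
- case/dvdzP: n2; exists (2 * (f ^+ 2 - g ^+ 2) * (alt4 c ^+ 2 - alt4 d ^+ 2)
    * (gauss4 c - gauss4 d) ^+ 2 * norm8 a b ^+ 2).
  by rewrite /n /q16_form fE gE; ring.
- rewrite /n q16_formC; apply: q16_form_odd_half; [by exists g | by exists f].
- apply: q16_form_odd_half; [by exists f | by exists g].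
case/dvdzP: n2; exists (2 * (f ^+ 2 + f - g ^+ 2 - g)
    * (alt4 c ^+ 2 - alt4 d ^+ 2)
    * (gauss4 c - gauss4 d) ^+ 2 * norm8 a b ^+ 2).
by rewrite /n /q16_form fE gE; ring.
Qed.

Lemma eqz_modP (n r d : int) : (n = r %[mod d])%Z <-> exists w, n = d * w + r.
Proof.
split=> [/eqP|[w ->]]; last by rewrite mulrC modzMDl.
rewrite eqz_mod_dvd => /dvdzP[w nE]; exists w.
by rewrite mulrC -nE subrK.
Qed.

(** * Families attaining every admissible value *)

Lemma int_mod4 (x : int) : exists k,
  [\/ x = 4 * k, x = 4 * k + 1, x = 4 * k + 2 | x = 4 * k + 3].
Proof.
have [[h ->]|[h ->]] := int_parity x; have [[k ->]|[k ->]] := int_parity h;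
  exists k; [constructor 1 | constructor 3 | constructor 2 | constructor 4];
    ring.
Qed.

(** Adding a constant to all coordinates of [s] and [t] changes only the coordinate sums, so [A] is
    linear in the constant and the other factors stay fixed. One such family serves each residue of
    [m] mod 4. *)
Lemma q16_form_even_value (m : int) : exists a b s t : int4,
  2 ^+ 10 * m = q16_form (add4 a (scale4 2 s)) (add4 b (scale4 2 t)) a b.
Proof.
have [k [] ->] := int_mod4 m.
- exists (1, -1, 0, 0), (0, 0, 0, 0), (- k, 1 - k, - k, - k),
    (- k - 1, - k, - k, - k).
  by rewrite /q16_form /norm8 /=; ring.
- exists (0, 0, 0, 0), (0, -1, 1, 0), (k, k, k, k), (1 + k, 1 + k, k, k).
  by rewrite /q16_form /norm8 /=; ring.
- exists (1, -1, 0, 0), (0, 0, 0, 0), (k, 1 + k, k, k),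
    (k, 1 + k, 1 + k, 1 + k).
  by rewrite /q16_form /norm8 /=; ring.
pose l := - k - 1.
exists (0, 0, 1, -1), (0, 0, 0, 0), (l - 1, l, l, l + 1), (l + 1, l + 1, l, l).
by rewrite /q16_form /norm8 /l /=; ring.
Qed.

Lemma q16_form_1mod8 (w : int) : exists a b s t : int4,
  8 * w + 1 = q16_form (add4 a (scale4 2 s)) (add4 b (scale4 2 t)) a b.
Proof.
have [[k ->]|[j ->]] := int_parity w.
  exists (1, 0, 0, 0), (0, 0, 0, 0), (k, k, k, k), (k, k, k, k).
  by rewrite /q16_form /norm8 /=; ring.
(* This family takes the value [- 16 k - 7], which is [16 j + 9]. *)
pose k := - j - 1.
exists (0, 1, -1, 1), (0, 0, 0, 0), (k + 1, k, k, k), (k + 1, k + 1, k, k).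
by rewrite /q16_form /norm8 /k /=; ring.
Qed.

(** For the normal residues shifted by [2 k], [B = 1], [C = -1] and [N = p], while [A] is [16 k + 5]
    if [t] is true and [- 16 k - 3] if it is false. *)
Lemma q16_form_5mod8 (w : int) (p : nat) : prime p -> (p %% 8 = 7)%N ->
  exists a b s t : int4, (8 * w + 5) * p%:Z ^+ 2 =
    q16_form (add4 a (scale4 2 s)) (add4 b (scale4 2 t)) a b.
Proof.
move=> pp p7.
have lift (c : int4) k x : cong2 c x -> exists s : int4,
    add4 x (scale4 2 s) = add4 c (2 * k, 2 * k, 2 * k, 2 * k).
  case=> -[[[s0 s1] s2] s3] ->; exists (k - s0, k - s1, k - s2, k - s3).
  by case: c => [[[? ?] ?] ?] /=; congr (_, _, _, _); ring.
have [[k ->]|[j ->]] := int_parity w.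
  have [a [b [ca cb E]]] := prime7_norm8_normal true pp p7.
  have [s sE] := lift _ k _ ca; have [t tE] := lift _ k _ cb.
  exists a, b, s, t; rewrite sE tE /q16_form E /=; ring.
have [a [b [ca cb E]]] := prime7_norm8_normal false pp p7.
have [s sE] := lift _ (- j - 1) _ ca; have [t tE] := lift _ (- j - 1) _ cb.
exists a, b, s, t; rewrite sE tE /q16_form E /=; ring.
Qed.

Theorem theorem1p1 (gT : finGroupType) (Q16 : Q16_presentation gT) :
  (forall n : int,
     (int_group_det gT n /\ (2 %| n)%Z) <-> (2 ^+ 10 %| n)%Z) /\
  (forall n : int,
     (int_group_det gT n /\ ~~ (2 %| n)%Z) <->
     ((n = 1 %[mod 8])%Z \/
      ((n = 5 %[mod 8])%Z /\
       exists (m : int) (p : nat),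
         [/\ (m = 5 %[mod 8])%Z, prime p, (p = 7 %[mod 8])%N
           & n = m * p%:Z ^+ 2]))).
Proof.
have odd_not2 (h : int) : ~~ (2 %| 2 * h + 1)%Z.
  by apply/dvdzP=> -[q]; clear; lia.
split=> n; split.
- by case=> /(int_group_det_Q16P _ Q16)[a [b [s [t ->]]]]; apply: q16_form_even.
- case/dvdzP=> m ->; split; last by rewrite dvdz_mull.
  apply/(int_group_det_Q16P _ Q16).
  by rewrite mulrC; apply: q16_form_even_value.
- case=> /(int_group_det_Q16P _ Q16)[a [b [s [t ->]]]] /q16_form_odd.
  case=> [[w wE]|[w [m [z [p [wE mE pp p7 nE]]]]]].
    by left; apply/eqz_modP; exists w.
  right; split; first by apply/eqz_modP; exists w.
  by exists m, p; split=> //; apply/eqz_modP; exists z.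
case=> [/eqz_modP[w ->]|[/eqz_modP[w nw] [m [p [/eqz_modP[z ->] pp p7 nE]]]]].
  split; first by apply/(int_group_det_Q16P _ Q16)/q16_form_1mod8.
  by have -> : 8 * w + 1 = 2 * (4 * w) + 1 by ring.
split; last by rewrite nw (_ : 8 * w + 5 = 2 * (4 * w + 2) + 1) //; ring.
by rewrite nE; apply/(int_group_det_Q16P _ Q16)/q16_form_5mod8.
Qed.
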